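(* Let $\kappa(t),\tau(t)$ be the curvature and torsion functions of a non-linear, non-circular geodesic front track in $\mathbb{R}^3$, parametrized by arc length, satisfying $$\kappa'' = \kappa\left[ \tau(\tau - b) + \frac{1 + a^2 - \kappa^2}{2}\right],\quad \kappa^2 (2 \tau-b)=b(a^2-1),\quad (\kappa ')^2+\frac{1}{4} \left( 1 + a^2 - \kappa^2 \right)^2+\kappa^2 (\tau-b)^2=a^2+b^2$$ with parameter values $a,b\in\mathbb{R}$, $a>0$. Set $$\tilde a:=\frac1a,\qquad \tilde b:=-\frac{b}{a}.$$ Then the non-linear geodesic front track associated with the parameter values $(\tilde a,\tilde b)$ has (for a suitable choice of the origin of arc length) curvature and torsion functions $$\tilde\kappa(t)=\frac1a\,\kappa\!\left(\frac ta\right),\qquad \tilde\tau(t)=\frac1a\,\tau\!\left(\frac ta\right)-\frac ba .$$ Namely, the new front track is obtained from the old one by torsion shifting, $\tau\mapsto\tau-b$, followed by rescaling by $\lambda=a$.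
   Context: A bicycle path in $\mathbb{R}^3$ is a pair of curves $(\mathbf{x}(t),\mathbf{y}(t))$ (front and back tracks) such that $\mathbf{v}:=\mathbf{x}-\mathbf{y}$ satisfies $|\mathbf{v}|=1$ and $\mathbf{y}'\parallel\mathbf{v}$. A bicycling geodesic is a bicycle path whose length (length of the front track) between any two of its placements is critical among bicycle paths connecting these placements; a geodesic front track is its front track $\mathbf{x}(t)$. Non-linear geodesic front tracks in $\mathbb{R}^3$ have curvature and torsion (as functions of arc length) satisfying the three displayed equations for some constants $a,b$; the front track associated with $(\tilde a,\tilde b)$ is the non-linear geodesic front track satisfying them with $(\tilde a,\tilde b)$ in place of $(a,b)$. Rescaling a curve by $\lambda>0$ means $\mathbf{x}(t)\mapsto\lambda\mathbf{x}(t/\lambda)$, which acts by $\kappa(t)\mapsto\frac1\lambda\kappa(\frac t\lambda)$, $\tau(t)\mapsto\frac1\lambda\tau(\frac t\lambda)$. The curvature and torsion are those of an analytic Frenet-Serret frame ($\mathbf{T}'=\kappa\mathbf{N}$, $\mathbf{N}'=-\kappa\mathbf{T}+\tau\mathbf{B}$, $\mathbf{B}'=-\tau\mathbf{N}$), so $\kappa$ may change sign at inflection points. *)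

(* Defs.v *)
From Stdlib Require Import Reals.
From Coquelicot Require Import Coquelicot.
Open Scope R_scope.

(** Coquelicot's product norm is sqrt(|u|^2 + |v|^2), so [norm] on [E3] is the
    Euclidean norm. *)
Definition E3 : NormedModule R_AbsRing :=
  prod_NormedModule R_AbsRing
    (prod_NormedModule R_AbsRing R_NormedModule R_NormedModule) R_NormedModule.

Definition c1 (u : E3) : R := fst (fst u).
Definition c2 (u : E3) : R := snd (fst u).
Definition c3 (u : E3) : R := snd u.

Definition dot (u v : E3) : R := c1 u * c1 v + c2 u * c2 v + c3 u * c3 v.

Definition cross (u v : E3) : E3 :=
  (c2 u * c3 v - c3 u * c2 v,
   c3 u * c1 v - c1 u * c3 v,
   c1 u * c2 v - c2 u * c1 v).

Definition smooth (f : R -> E3) : Prop :=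
  forall (n : nat) (t : R),
    ex_derive_n (fun u => c1 (f u)) n t /\
    ex_derive_n (fun u => c2 (f u)) n t /\
    ex_derive_n (fun u => c3 (f u)) n t.

Definition smooth2 (F : R -> R -> E3) : Prop :=
  forall (n : nat) (s t : R),
    ex_diff_n (fun u v => c1 (F u v)) n s t /\
    ex_diff_n (fun u v => c2 (F u v)) n s t /\
    ex_diff_n (fun u v => c3 (F u v)) n s t.

Definition analytic {V : NormedModule R_AbsRing} (f : R -> V) : Prop :=
  forall t0 : R, exists c : nat -> V,
    locally t0 (fun t => is_pseries c (t - t0) (f t)).

Definition velocity (f : R -> E3) (t : R) : E3 :=
  (Derive (fun u => c1 (f u)) t,
   Derive (fun u => c2 (f u)) t,
   Derive (fun u => c3 (f u)) t).

Definition length (f : R -> E3) (t0 t1 : R) : R :=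
  RInt (fun t => norm (velocity f t)) t0 t1.

(** Front track [x], back track [y]: unit frame [x - y], and [y'] parallel to it. *)
Definition bicycle_at (x y : R -> E3) (t : R) : Prop :=
  norm (minus (x t) (y t)) = 1 /\
  exists c : R, is_derive y t (scal c (minus (x t) (y t))).

Definition bicycle_path (x y : R -> E3) : Prop :=
  smooth x /\ smooth y /\ forall t, bicycle_at x y t.

(** A one-parameter family of bicycle paths on [t0, t1], with parameter [s] near
    0, equal to [(x, y)] for [s = 0] and with the placements at [t0] and [t1] held
    fixed.  [X] and [Y] are defined on the whole plane only so that smoothness up
    to the ends of [t0, t1] needs no one-sided derivatives. *)
Definition variation (x y : R -> E3) (t0 t1 : R) (X Y : R -> R -> E3) : Prop :=
  smooth2 X /\ smooth2 Y /\
  (forall t, t0 <= t <= t1 -> X 0 t = x t /\ Y 0 t = y t) /\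
  locally 0 (fun s : R =>
    (forall t, t0 <= t <= t1 -> bicycle_at (X s) (Y s) t) /\
    X s t0 = x t0 /\ Y s t0 = y t0 /\ X s t1 = x t1 /\ Y s t1 = y t1).

Definition bicycling_geodesic (x y : R -> E3) : Prop :=
  bicycle_path x y /\
  forall (t0 t1 : R) (X Y : R -> R -> E3),
    t0 < t1 -> variation x y t0 t1 X Y ->
    is_derive (fun s : R => length (X s) t0 t1) 0 0.

Definition geodesic_front_track (x : R -> E3) : Prop :=
  exists y : R -> E3, bicycling_geodesic x y.

Definition linear_track (x : R -> E3) : Prop :=
  exists p d : E3, forall t, exists c : R, x t = plus p (scal c d).

Definition circular_track (x : R -> E3) : Prop :=
  exists (p n : E3) (r : R), n <> zero /\ 0 < r /\
    forall t, norm (minus (x t) p) = r /\ dot n (minus (x t) p) = 0.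

(** [kappa] and [tau] are curvature and torsion of [x], parametrized by arc
    length, with respect to some analytic Frenet-Serret frame; [kappa] is signed,
    and [(T, N, B)], [(T, -N, -B)] give opposite curvatures and equal torsions. *)
Definition curvature_torsion (x : R -> E3) (kappa tau : R -> R) : Prop :=
  exists T N B : R -> E3,
    (analytic T /\ analytic N /\ analytic B) /\
    (analytic (V := R_NormedModule) kappa /\
     analytic (V := R_NormedModule) tau) /\
    forall t,
      (norm (T t) = 1 /\ norm (N t) = 1 /\ dot (T t) (N t) = 0 /\
       B t = cross (T t) (N t)) /\
      is_derive x t (T t) /\
      is_derive T t (scal (kappa t) (N t)) /\
      is_derive N t (plus (scal (- kappa t) (T t)) (scal (tau t) (B t))) /\
      is_derive B t (scal (- tau t) (N t)).

Definition geodesic_equations (a b : R) (kappa tau : R -> R) : Prop :=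
  forall t,
    Derive_n kappa 2 t =
      kappa t * (tau t * (tau t - b) + (1 + a ^ 2 - kappa t ^ 2) / 2) /\
    kappa t ^ 2 * (2 * tau t - b) = b * (a ^ 2 - 1) /\
    Derive kappa t ^ 2 + 1 / 4 * (1 + a ^ 2 - kappa t ^ 2) ^ 2
      + kappa t ^ 2 * (tau t - b) ^ 2 = a ^ 2 + b ^ 2.

(** For a > 0, such an [x] is unique up to rigid motions and the choice of the origin of arc
    length. *)
Definition front_track_with_parameters (a b : R) (x : R -> E3) : Prop :=
  geodesic_front_track x /\ ~ linear_track x /\
  exists kappa tau : R -> R,
    curvature_torsion x kappa tau /\ geodesic_equations a b kappa tau.

(* Main.v *)
Require Import Defs.
From Stdlib Require Import Reals Lra Lia Psatz Factorial Wf_nat Classical.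
From Coquelicot Require Import Coquelicot.
Open Scope R_scope.

(** Write u = kappa^2.  The equations with parameters (a, b) give
    u'^2 = (u + b^2) (u - (a - 1)^2) ((a + 1)^2 - u)
    ([curvature_square_first_integral]).  The roots of this cubic are divided
    by a^2 when (a, b) is replaced by (1/a, -b/a), so the rescaled curvature
    satisfies the new equation, and the shift of the torsion is what the
    algebraic relation between kappa and tau then requires
    ([geodesic_data_torsion_shift]).  It remains to see that the new functions
    belong to a geodesic front track, and that they are the only ones up to the
    origin of arc length and the sign of the curvature.

    Uniqueness.  A curvature function that is not identically zero reaches
    kappa^2 = (a + 1)^2 somewhere, with kappa' = 0 ([curvature_maximum]):
    otherwise sqrt((a + 1)^2 - kappa^2) would be a positive concave function on
    the whole line, hence constant.  Once two solutions have a maximum of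
    kappa^2 at the same place, the squares solve the same second-order equation
    with the same initial values, and the curvatures up to sign and the torsions
    agree ([curvature_determined]).  A change of sign of the curvature is
    absorbed by reversing N and B.

    Existence.  Analytic kappa and tau are realized by a global analytic Frenet
    frame ([frenet_frame_exists]); this is the theory of linear differential
    equations, the series of iterated integrals giving a global solution
    ([linear_solution_exists]) and a majorized power series its analyticity
    ([linear_solution_analytic]).  A curve whose curvature and torsion satisfy the
    equations is a geodesic front track ([front_track_is_geodesic]).  Indeed the
    equations imply that
      p = (1 + a^2 - kappa^2)/2 T - kappa' N - kappa (tau - b) B
    is a constant vector.  With r = T - p and M = b T + kappa B one has
    |r| = |M|, r.M = 0, and the unit vector v = (r x M)/|M|^2 is the frame of a
    bicycle path with front track x.  The pair (p, r) is the costate of the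
    variational problem: along any variation with frame V, the integral of
    T.X_t + (terms of second order) is the increment of p.X + r.V plus a
    constant, and the increment depends on the end placements only.  So the
    first variation of length vanishes ([length_critical_of_costate]). *)

(** * Linear differential equations: growth estimate and uniqueness *)

Lemma is_derive_continuity_pt (f : R -> R) (t l : R) :
  is_derive f t l -> continuity_pt f t.
Proof.
  intros H; apply continuity_pt_filterlim, (ex_derive_continuous f); now exists l.
Qed.

Lemma is_derive_sum_f_R0 (f d : nat -> R -> R) (m : nat) (t : R) :
  (forall j, (j <= m)%nat -> is_derive (f j) t (d j t)) ->
  is_derive (fun s => sum_f_R0 (fun j => f j s) m) t (sum_f_R0 (fun j => d j t) m).
Proof.
  intros H.
  apply (is_derive_ext (fun s => sum_n (fun j => f j s) m)).
  { intros s; apply sum_n_Reals. }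
  rewrite <- sum_n_Reals.
  apply (is_derive_sum_n (fun j s => f j s) m t (fun j => d j t)); exact H.
Qed.

Lemma is_derive_power_term (K t0 s : R) (n : nat) :
  is_derive (fun s => K * (s - t0) ^ S n / INR (S n)) s (K * (s - t0) ^ n).
Proof.
  assert (HS : INR (S n) <> 0) by (apply not_0_INR; lia).
  auto_derive; [easy |].
  change (match n with 0%nat => 1 | S _ => INR n + 1 end) with (INR (S n)).
  unfold Rminus; field; exact HS.
Qed.

Lemma power_growth_right (f : R -> R) (df : R -> R) (t0 t K : R) (n : nat) :
  t0 <= t -> f t0 = 0 ->
  (forall s, t0 <= s <= t -> is_derive f s (df s)) ->
  (forall s, t0 <= s <= t -> df s <= K * (s - t0) ^ n) ->
  f t <= K * (t - t0) ^ S n / INR (S n).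
Proof.
  intros Htt Hf0 Hd Hb.
  assert (HS : INR (S n) <> 0) by (apply not_0_INR; lia).
  destruct (MVT_gen (fun s => K * (s - t0) ^ S n / INR (S n) - f s) t0 t
              (fun s => K * (s - t0) ^ n - df s)) as [c [Hc E]].
  - rewrite Rmin_left, Rmax_right by lra; intros s Hs.
    apply @is_derive_minus; [| apply Hd; lra].
    now apply is_derive_power_term.
  - rewrite Rmin_left, Rmax_right by lra; intros s Hs.
    apply (is_derive_continuity_pt _ _ (K * (s - t0) ^ n - df s)).
    apply @is_derive_minus; [| apply Hd; lra].
    now apply is_derive_power_term.
  - rewrite Rmin_left, Rmax_right in Hc by lra.
    specialize (Hb c Hc).
    assert (H0 : K * (t0 - t0) ^ S n / INR (S n) - f t0 = 0).
    { rewrite Hf0; simpl; field; exact HS. }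
    rewrite H0 in E.
    assert (0 <= (K * (c - t0) ^ n - df c) * (t - t0)) by (apply Rmult_le_pos; lra).
    lra.
Qed.

Lemma power_growth_right_abs (f : R -> R) (df : R -> R) (t0 t K : R) (n : nat) :
  t0 <= t -> f t0 = 0 ->
  (forall s, t0 <= s <= t -> is_derive f s (df s)) ->
  (forall s, t0 <= s <= t -> Rabs (df s) <= K * (s - t0) ^ n) ->
  Rabs (f t) <= K * (t - t0) ^ S n / INR (S n).
Proof.
  intros Htt Hf0 Hd Hb.
  apply Rabs_le; split.
  - assert (- f t <= K * (t - t0) ^ S n / INR (S n)); [| lra].
    apply (power_growth_right (fun s => - f s) (fun s => - df s)); try assumption.
    + now rewrite Hf0, Ropp_0.
    + intros s Hs; apply @is_derive_opp; now apply Hd.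
    + intros s Hs; specialize (Hb s Hs); apply Rabs_le_between in Hb; lra.
  - apply (power_growth_right f df); try assumption.
    intros s Hs; specialize (Hb s Hs); apply Rabs_le_between in Hb; lra.
Qed.

Lemma power_growth (f : R -> R) (df : R -> R) (t0 r K : R) (n : nat) :
  f t0 = 0 ->
  (forall s, Rabs (s - t0) < r -> is_derive f s (df s)) ->
  (forall s, Rabs (s - t0) < r -> Rabs (df s) <= K * Rabs (s - t0) ^ n) ->
  forall t, Rabs (t - t0) < r -> Rabs (f t) <= K * Rabs (t - t0) ^ S n / INR (S n).
Proof.
  intros Hf0 Hd Hb t Ht.
  destruct (Rle_lt_dec t0 t) as [Htt | Htt].
  - rewrite (Rabs_pos_eq (t - t0)) in Ht |- * by lra.
    apply power_growth_right_abs with df; try assumption; intros s Hs.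
    + apply Hd; rewrite Rabs_pos_eq; lra.
    + rewrite <- (Rabs_pos_eq (s - t0)) by lra.
      apply Hb; rewrite Rabs_pos_eq; lra.
  (* The reflection s -> 2 t0 - s exchanges the two sides of t0. *)
  - rewrite (Rabs_left (t - t0)) in Ht |- * by lra.
    replace (- (t - t0)) with ((2 * t0 - t) - t0) in Ht |- * by ring.
    replace t with (2 * t0 - (2 * t0 - t)) at 1 by ring.
    apply (power_growth_right_abs (fun s => f (2 * t0 - s))
             (fun s => - df (2 * t0 - s))); try lra.
    + now replace (2 * t0 - t0) with t0 by ring.
    + intros s Hs.
      replace (- df (2 * t0 - s)) with (scal (-1) (df (2 * t0 - s)))
        by (unfold scal; simpl; unfold mult; simpl; ring).
      apply (is_derive_comp f).
      * apply Hd; rewrite Rabs_left1; lra.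
      * auto_derive; [easy | ring].
    + intros s Hs; rewrite Rabs_Ropp.
      replace (s - t0) with (Rabs (2 * t0 - s - t0)) by (rewrite Rabs_left1; lra).
      apply Hb; rewrite Rabs_left1; lra.
Qed.

Definition linear_field (m : nat) (A : nat -> nat -> R -> R) (y : nat -> R -> R)
  (i : nat) (t : R) : R :=
  sum_f_R0 (fun j => A i j t * y j t) m.

Definition linear_solution (m : nat) (A : nat -> nat -> R -> R) (y : nat -> R -> R)
  (t : R) : Prop :=
  forall i, (i <= m)%nat -> is_derive (y i) t (linear_field m A y i t).

Lemma linear_field_abs_le m A y i t C W :
  sum_f_R0 (fun j => Rabs (A i j t)) m <= C -> 0 <= W ->
  (forall j, (j <= m)%nat -> Rabs (y j t) <= W) ->
  Rabs (linear_field m A y i t) <= C * W.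
Proof.
  intros HC HW Hy; unfold linear_field.
  eapply Rle_trans; [apply Rsum_abs |].
  apply Rle_trans with (sum_f_R0 (fun j => Rabs (A i j t)) m * W).
  - rewrite Rmult_comm, scal_sum.
    apply sum_Rle; intros j Hj; rewrite Rabs_mult.
    apply Rmult_le_compat_l; [apply Rabs_pos | now apply Hy].
  - now apply Rmult_le_compat_r.
Qed.

(** Used twice: for the increments of the successive approximations to a
    solution, and for the constant sequence D n = y when y solves the homogeneous
    system and vanishes at [t0]. *)
Lemma picard_bound m A (D : nat -> nat -> R -> R) t0 r C W :
  0 <= W -> 0 <= C ->
  (forall i t, (i <= m)%nat -> Rabs (t - t0) < r ->
     sum_f_R0 (fun j => Rabs (A i j t)) m <= C) ->
  (forall i t, (i <= m)%nat -> Rabs (t - t0) < r -> Rabs (D 0%nat i t) <= W) ->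
  (forall n i, (i <= m)%nat -> D (S n) i t0 = 0) ->
  (forall n i t, (i <= m)%nat -> Rabs (t - t0) < r ->
     is_derive (D (S n) i) t (linear_field m A (D n) i t)) ->
  forall n i t, (i <= m)%nat -> Rabs (t - t0) < r ->
    Rabs (D n i t) <= W * ((C * Rabs (t - t0)) ^ n / INR (fact n)).
Proof.
  intros HW HC HA H0 HD0 HD n; induction n as [| n IH]; intros i t Hi Ht.
  - simpl; specialize (H0 i t Hi Ht); lra.
  - assert (Hf : INR (fact n) <> 0) by apply INR_fact_neq_0.
    assert (HS : INR (S n) <> 0) by (apply not_0_INR; lia).
    replace (W * ((C * Rabs (t - t0)) ^ S n / INR (fact (S n))))
      with (C * W * C ^ n / INR (fact n) * Rabs (t - t0) ^ S n / INR (S n)).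
    2: { rewrite fact_simpl, mult_INR, !Rpow_mult_distr.
         rewrite <- !tech_pow_Rmult; field; split; assumption. }
    apply (power_growth (D (S n) i) (linear_field m A (D n) i) t0 r); try assumption.
    + now apply HD0.
    + intros s Hs; now apply HD.
    + intros s Hs.
      replace (C * W * C ^ n / INR (fact n) * Rabs (s - t0) ^ n)
        with (C * (W * ((C * Rabs (s - t0)) ^ n / INR (fact n))))
        by (rewrite Rpow_mult_distr; field; exact Hf).
      apply linear_field_abs_le.
      * now apply HA.
      * apply Rmult_le_pos; [exact HW |].
        apply Rmult_le_pos;
          [apply pow_le, Rmult_le_pos; [exact HC | apply Rabs_pos] |].
        apply Rlt_le, Rinv_0_lt_compat, INR_fact_lt_0.
      * intros j Hj; now apply IH.
Qed.

Lemma is_series_exp_terms x : is_series (fun n => x ^ n / INR (fact n)) (exp x).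
Proof.
  generalize (is_exp_Reals x); apply is_series_ext; intros n.
  rewrite pow_n_pow; unfold scal; simpl; unfold mult; simpl; reflexivity.
Qed.

Lemma exp_terms_small x eps :
  0 < eps -> exists N, forall n, (N <= n)%nat -> Rabs (x ^ n / INR (fact n)) < eps.
Proof.
  intros He.
  assert (H : is_lim_seq (fun n => x ^ n / INR (fact n)) 0)
    by (apply ex_series_lim_0; eexists; apply is_series_exp_terms).
  apply is_lim_seq_spec in H; destruct (H (mkposreal eps He)) as [N HN].
  exists N; intros n Hn; specialize (HN n Hn); simpl in HN.
  now rewrite Rminus_0_r in HN.
Qed.

(** Merges finitely many existential bounds without choosing them. *)
Lemma finite_bound (m : nat) (P : nat -> R -> Prop) :
  (forall i x y, P i x -> x <= y -> P i y) ->
  (forall i, exists x, P i x) ->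
  exists x, 0 <= x /\ forall i, (i <= m)%nat -> P i x.
Proof.
  intros Hm Hex; induction m as [| m [x [Hx H]]].
  - destruct (Hex 0%nat) as [x Hx]; exists (Rmax 0 x); split; [apply Rmax_l |].
    intros i Hi; replace i with 0%nat by lia.
    apply (Hm _ x); [exact Hx | apply Rmax_r].
  - destruct (Hex (S m)) as [x' Hx']; exists (Rmax x x'); split.
    { eapply Rle_trans; [exact Hx | apply Rmax_l]. }
    intros i Hi; destruct (Nat.eq_dec i (S m)) as [-> | Hn].
    + apply (Hm _ x'); [exact Hx' | apply Rmax_r].
    + apply (Hm _ x); [apply H; lia | apply Rmax_l].
Qed.

Lemma continuous_bounded_near (f : R -> R) t0 r :
  (forall t, continuity_pt f t) ->
  exists M, forall t, Rabs (t - t0) < r -> Rabs (f t) <= M.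
Proof.
  intros Hc; destruct (Rlt_le_dec 0 r) as [Hr | Hr].
  - destruct (continuity_ab_maj (fun t => Rabs (f t)) (t0 - r) (t0 + r)) as [x [Hx _]].
    + lra.
    + intros c _; apply (continuity_pt_comp f Rabs); [apply Hc | apply Rcontinuity_abs].
    + exists (Rabs (f x)); intros t Ht; apply Hx; apply Rabs_lt_between in Ht; lra.
  - exists 0; intros t Ht; pose proof (Rabs_pos (t - t0)); lra.
Qed.

Lemma continuous_system_bounded m (A : nat -> nat -> R -> R) t0 r :
  (forall i j t, continuity_pt (A i j) t) ->
  exists C, 0 <= C /\ forall i t, (i <= m)%nat -> Rabs (t - t0) < r ->
    sum_f_R0 (fun j => Rabs (A i j t)) m <= C.
Proof.
  intros Hc.
  destruct (finite_bound m (fun i C => forall t, Rabs (t - t0) < r ->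
    sum_f_R0 (fun j => Rabs (A i j t)) m <= C)) as [C [HC H]].
  - intros i x y Hx Hxy t Ht; eapply Rle_trans; [apply Hx, Ht | exact Hxy].
  - intros i.
    destruct (finite_bound m (fun j M => forall t, Rabs (t - t0) < r ->
      Rabs (A i j t) <= M)) as [M [HM H]].
    + intros j x y Hx Hxy t Ht; eapply Rle_trans; [apply Hx, Ht | exact Hxy].
    + intros j; now apply continuous_bounded_near.
    + exists (sum_f_R0 (fun _ => M) m); intros t Ht.
      apply sum_Rle; intros j Hj; now apply H.
  - exists C; split; [exact HC |]; intros i t Hi Ht; now apply H.
Qed.

(** A solution vanishing at [t0] is its own successive approximation of every
    order, hence is smaller than every term of an exponential series. *)
Lemma linear_solution_zero m A y t0 r :
  (forall i j t, continuity_pt (A i j) t) ->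
  (forall t, Rabs (t - t0) < r -> linear_solution m A y t) ->
  (forall i, (i <= m)%nat -> y i t0 = 0) ->
  forall i t, (i <= m)%nat -> Rabs (t - t0) < r -> y i t = 0.
Proof.
  intros HA Hy H0 i t Hi Ht.
  (* A closed interval inside the open one on which y is bounded. *)
  set (r' := (Rabs (t - t0) + r) / 2).
  assert (Hr' : Rabs (t - t0) < r' < r) by (unfold r'; lra).
  destruct (continuous_system_bounded m A t0 r' HA) as [C [HC HAC]].
  destruct (finite_bound m (fun i W => (i <= m)%nat -> forall s, Rabs (s - t0) < r' ->
    Rabs (y i s) <= W)) as [W [HW HyW]].
  - intros j x z Hx Hxz Hj s Hs; eapply Rle_trans; [apply Hx; assumption | exact Hxz].
  - intros j; destruct (Compare_dec.le_dec j m) as [Hj | Hj]; [| now exists 0].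
    destruct (continuity_ab_maj (fun s => Rabs (y j s)) (t0 - r') (t0 + r'))
      as [x [Hx _]].
    + pose proof (Rabs_pos (t - t0)); lra.
    + intros c Hc; apply (continuity_pt_comp (y j) Rabs); [| apply Rcontinuity_abs].
      eapply is_derive_continuity_pt, Hy; [| exact Hj].
      apply Rabs_lt_between; lra.
    + exists (Rabs (y j x)); intros _ s Hs; apply Hx.
      apply Rabs_lt_between in Hs; lra.
  - assert (B : forall n, Rabs (y i t) <= W * ((C * Rabs (t - t0)) ^ n / INR (fact n))).
    { intros n.
      apply (picard_bound m A (fun _ => y) t0 r' C W HW HC HAC); auto; try lra.
      intros _ j s Hj Hs; apply Hy; [lra | exact Hj]. }
    destruct (Req_dec (y i t) 0) as [E | E]; [exact E | exfalso].
    apply Rabs_pos_lt in E.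
    destruct (exp_terms_small (C * Rabs (t - t0)) (Rabs (y i t) / (W + 1)))
      as [N HN]; [apply Rdiv_lt_0_compat; lra |].
    specialize (HN N (Nat.le_refl N)); specialize (B N).
    apply Rabs_lt_between in HN; destruct HN as [_ HN].
    assert (W * ((C * Rabs (t - t0)) ^ N / INR (fact N))
            <= W * (Rabs (y i t) / (W + 1))) by (apply Rmult_le_compat_l; lra).
    assert (W * (Rabs (y i t) / (W + 1)) < Rabs (y i t)); [| lra].
    apply Rmult_lt_reg_r with (W + 1); [lra |].
    field_simplify; [nra | lra].
Qed.

(** * Linear differential equations: global existence *)

Lemma is_derive_RInt_continuous (f : R -> R) (t0 t : R) :
  (forall s, continuity_pt f s) -> is_derive (fun s => RInt f t0 s) t (f t).
Proof.
  intros Hf.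
  assert (Hc : forall s, continuous f s)
    by (intros s; now apply continuity_pt_filterlim).
  apply (is_derive_RInt f _ t0); [| apply Hc].
  apply filter_forall; intros s; apply @RInt_correct.
  now apply @ex_RInt_continuous.
Qed.

Lemma continuity_pt_sum (f : nat -> R -> R) m t :
  (forall j, (j <= m)%nat -> continuity_pt (f j) t) ->
  continuity_pt (fun s => sum_f_R0 (fun j => f j s) m) t.
Proof.
  intros H; induction m as [| m IH]; simpl.
  - apply (H 0%nat); lia.
  - apply (continuity_pt_plus (fun s => sum_f_R0 (fun j => f j s) m) (f (S m))).
    + apply IH; intros j Hj; apply H; lia.
    + apply H; lia.
Qed.

Lemma linear_field_continuity m A y i t :
  (forall i j t, continuity_pt (A i j) t) ->
  (forall j, (j <= m)%nat -> continuity_pt (y j) t) ->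
  continuity_pt (linear_field m A y i) t.
Proof.
  intros HA Hy; apply continuity_pt_sum; intros j Hj.
  apply (continuity_pt_mult (A i j) (y j)); auto.
Qed.

(** The iterated integrals of the system, applied to the constant vector w. *)
Fixpoint picard_term (m : nat) (A : nat -> nat -> R -> R) (w : nat -> R) (n : nat)
  : nat -> R -> R :=
  match n with
  | 0%nat => fun i _ => w i
  | S n' => fun i t => RInt (linear_field m A (picard_term m A w n') i) 0 t
  end.

Lemma picard_term_continuity m A w :
  (forall i j t, continuity_pt (A i j) t) ->
  forall n i t, continuity_pt (picard_term m A w n i) t.
Proof.
  intros HA n; induction n as [| n IH]; intros i t.
  - apply (continuity_pt_const (fun _ => w i)); now intros x y.
  - eapply is_derive_continuity_pt, is_derive_RInt_continuous.
    intros s; apply linear_field_continuity; auto.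
Qed.

Lemma picard_term_derive m A w :
  (forall i j t, continuity_pt (A i j) t) ->
  forall n i t, is_derive (picard_term m A w (S n) i) t
                  (linear_field m A (picard_term m A w n) i t).
Proof.
  intros HA n i t; apply is_derive_RInt_continuous.
  intros s; apply linear_field_continuity; [exact HA |].
  intros j _; now apply picard_term_continuity.
Qed.

(** The terms of the series of iterated integrals are dominated, for |t| < r, by
    those of the series of exp (C r).  Hence the partial sums and their derivatives
    converge uniformly on bounded intervals. *)
Lemma linear_solution_exists m A (w : nat -> R) :
  (forall i j t, continuity_pt (A i j) t) ->
  exists y, (forall t, linear_solution m A y t) /\
            forall i, (i <= m)%nat -> y i 0 = w i.
Proof.
  intros HA.
  set (D := picard_term m A w).
  set (y := fun i t => Series (fun n => D n i t)).
  exists y; split.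
  2: { intros i Hi; unfold y.
       apply is_series_unique.
       apply (filterlim_ext (fun _ => w i)); [| apply filterlim_const].
       intros n; induction n as [| n IH]; [now rewrite sum_O |].
       rewrite sum_Sn, <- IH; unfold D; simpl; rewrite RInt_point.
       symmetry; apply Rplus_0_r. }
  intros t1.
  set (r := Rabs t1 + 1).
  assert (Hr : 0 < r) by (unfold r; pose proof (Rabs_pos t1); lra).
  destruct (continuous_system_bounded m A 0 r HA) as [C [HC HAC]].
  destruct (finite_bound m (fun i W => Rabs (w i) <= W)) as [W [HW HwW]].
  { intros i x z Hx Hxz; lra. }
  { intros i; exists (Rabs (w i)); apply Rle_refl. }
  set (b := fun n => W * ((C * r) ^ n / INR (fact n))).
  assert (Hb : is_series b (W * exp (C * r)))
    by (apply @is_series_scal; apply is_series_exp_terms).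
  assert (HD : forall n i t, (i <= m)%nat -> Rabs (t - 0) < r -> Rabs (D n i t) <= b n).
  { intros n i t Hi Ht.
    eapply Rle_trans.
    - apply (picard_bound m A D 0 r C W); auto.
      + intros j s Hj _; now apply HwW.
      + intros k j _; unfold D; simpl; now rewrite RInt_point.
      + intros k j s _ _; now apply picard_term_derive.
    - apply Rmult_le_compat_l; [exact HW |].
      apply Rmult_le_compat_r; [apply Rlt_le, Rinv_0_lt_compat, INR_fact_lt_0 |].
      apply pow_incr; split; [apply Rmult_le_pos; [exact HC | apply Rabs_pos] |].
      apply Rmult_le_compat_l; lra. }
  assert (Hex : forall i t, (i <= m)%nat -> Rabs (t - 0) < r ->
    ex_series (fun n => Rabs (D n i t))).
  { intros i t Hi Ht; apply (@ex_series_le R_AbsRing R_CompleteNormedModule _ b);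
      [| now eexists; apply Hb].
    intros n; unfold norm; simpl; unfold abs; simpl; rewrite Rabs_Rabsolu; now apply HD. }
  set (tail := fun n => W * exp (C * r) - sum_f_R0 b n).
  assert (Htail : forall n i t, (i <= m)%nat -> Rabs (t - 0) < r ->
    Rabs (y i t - sum_f_R0 (fun k => D k i t) n) <= tail n).
  { intros n i t Hi Ht; unfold tail, y.
    rewrite <- (is_series_unique _ _ Hb).
    rewrite (Series_incr_n (fun k => D k i t) (S n)) by
      (lia || apply ex_series_Rabs; now apply Hex).
    rewrite (Series_incr_n b (S n)) by (lia || (eexists; apply Hb)).
    simpl Init.Nat.pred.
    replace (_ + _ - _) with (Series (fun k => D (S n + k)%nat i t)) by ring.
    replace (_ + _ - _) with (Series (fun k => b (S n + k)%nat)) by ring.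
    eapply Rle_trans; [apply Series_Rabs |].
    - apply (ex_series_incr_n (fun k => Rabs (D k i t)) (S n)); now apply Hex.
    - apply Series_le.
      + intros k; split; [apply Rabs_pos | now apply HD].
      + apply (ex_series_incr_n b (S n)); eexists; apply Hb. }
  assert (Htail0 : forall eps, 0 < eps -> exists N, forall n, (N <= n)%nat -> tail n < eps).
  { intros eps He.
    assert (Hl : is_lim_seq (sum_f_R0 b) (W * exp (C * r))).
    { apply (is_lim_seq_ext (sum_n b)); [intros n; apply sum_n_Reals | exact Hb]. }
    apply is_lim_seq_spec in Hl; destruct (Hl (mkposreal eps He)) as [N HN].
    exists N; intros n Hn; specialize (HN n Hn); simpl in HN.
    apply Rabs_lt_between in HN; unfold tail; lra. }
  intros i Hi.
  apply is_derive_Reals.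
  apply (CVU_derivable (fun n s => sum_f_R0 (fun k => D k i s) (S n))
    (fun n s => linear_field m A (fun j s' => sum_f_R0 (fun k => D k j s') n) i s)
    (y i) (fun s => linear_field m A y i s) 0 (mkposreal r Hr)).
  - intros eps He.
    destruct (Htail0 (eps / (C + 1))) as [N HN]; [apply Rdiv_lt_0_compat; lra |].
    exists N; intros n s Hn Hs; unfold Boule in Hs; simpl in Hs.
    specialize (HN n Hn).
    replace (_ - _) with (linear_field m A
      (fun j s' => y j s' - sum_f_R0 (fun k => D k j s') n) i s).
    2: { unfold linear_field; rewrite <- minus_sum; apply sum_eq; intros; ring. }
    apply Rle_lt_trans with (C * tail n).
    + apply linear_field_abs_le; [now apply HAC | | intros j Hj; now apply Htail].
      eapply Rle_trans; [apply Rabs_pos | now apply (Htail n i s)].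
    + apply Rle_lt_trans with (C * (eps / (C + 1))).
      { apply Rmult_le_compat_l; lra. }
      apply Rmult_lt_reg_r with (C + 1); [lra |].
      field_simplify; [nra | lra].
  - intros s Hs; unfold Boule in Hs; simpl in Hs.
    intros eps He; destruct (Htail0 eps He) as [N HN].
    exists N; intros n Hn; unfold Rdist; rewrite Rabs_minus_sym.
    eapply Rle_lt_trans; [apply Htail; assumption | apply HN; lia].
  - intros n s Hs; apply is_derive_Reals.
    apply (is_derive_ext (fun s => w i + sum_f_R0 (fun k => D (S k) i s) n)).
    { intros u; now rewrite (decomp_sum (fun k => D k i u) (S n)) by lia. }
    replace (linear_field _ _ _ _ _) with
      (0 + sum_f_R0 (fun k => linear_field m A (D k) i s) n).
    + apply @is_derive_plus; [apply @is_derive_const |].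
      apply (is_derive_sum_f_R0 (fun k s => D (S k) i s)
        (fun k s => linear_field m A (D k) i s)).
      intros k _; now apply picard_term_derive.
    + rewrite Rplus_0_l; unfold linear_field; clear.
      induction n as [| n IH]; simpl; [reflexivity |].
      rewrite IH, <- plus_sum; apply sum_eq; intros j _; ring.
  - unfold Boule; simpl; rewrite Rminus_0_r; unfold r; lra.
Qed.

(** * Analytic functions and analytic solutions *)

Lemma CV_radius_geometric (c : nat -> R) M s x :
  0 < s -> (forall n, Rabs (c n) <= M * s ^ n) -> Rabs x * s < 1 ->
  Rbar_lt (Rabs x) (CV_radius c).
Proof.
  intros Hs Hc Hx.
  assert (Hx' : Rabs x < / s).
  { apply Rmult_lt_reg_r with s; [exact Hs |]; rewrite Rinv_l; lra. }
  set (r := (Rabs x + / s) / 2).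
  apply Rbar_lt_le_trans with r; [simpl; unfold r; lra |].
  apply (CV_radius_bounded c); exists M; intros n.
  assert (Hr : 0 < r) by (unfold r; pose proof (Rabs_pos x); lra).
  assert (Hrs : r * s <= 1).
  { apply Rmult_le_reg_r with (/ s); [now apply Rinv_0_lt_compat |].
    rewrite Rmult_assoc, Rinv_r, Rmult_1_l by lra; unfold r; lra. }
  assert (HM : 0 <= M).
  { specialize (Hc 0%nat); simpl in Hc; pose proof (Rabs_pos (c 0%nat)); lra. }
  rewrite Rabs_mult, <- RPow_abs, (Rabs_pos_eq r) by lra.
  apply Rle_trans with (M * s ^ n * r ^ n).
  { apply Rmult_le_compat_r; [apply pow_le; lra | apply Hc]. }
  rewrite Rmult_assoc, <- Rpow_mult_distr.
  rewrite <- (Rmult_1_r M) at 2; apply Rmult_le_compat_l; [exact HM |].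
  rewrite <- (pow1 n); apply pow_incr; split; [apply Rmult_le_pos; lra | lra].
Qed.

(** A single constant controls both the coefficients and the disk, so that
    finitely many expansions get a common one by enlarging it
    ([geometric_at_le]). *)
Definition geometric_at (rho : R) (f : R -> R) (t0 : R) (c : nat -> R) : Prop :=
  (forall k, Rabs (c k) <= rho * rho ^ k) /\
  (forall t, Rabs (t - t0) * rho < 1 -> is_pseries c (t - t0) (f t)).

Lemma geometric_at_le rho rho' f t0 c :
  0 <= rho -> rho <= rho' -> geometric_at rho f t0 c -> geometric_at rho' f t0 c.
Proof.
  intros H0 H [Hc Hs]; split.
  - intros k; eapply Rle_trans; [apply Hc |].
    apply Rmult_le_compat; [lra | now apply pow_le | lra | apply pow_incr; lra].
  - intros t Ht; apply Hs.
    apply Rle_lt_trans with (Rabs (t - t0) * rho'); [| exact Ht].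
    apply Rmult_le_compat_l; [apply Rabs_pos | exact H].
Qed.

(** The terms of a series that converges at distance d/2 are bounded there. *)
Lemma analytic_geometric (f : R -> R) t0 :
  analytic (V := R_NormedModule) f ->
  exists rho c, 0 < rho /\ geometric_at rho f t0 c.
Proof.
  intros Hf; destruct (Hf t0) as [c [d Hd]].
  assert (Hp : 0 < d) by apply cond_pos.
  assert (Hx : is_pseries c (d / 2) (f (t0 + d / 2))).
  { replace (d / 2) with (t0 + d / 2 - t0) at 1 by ring.
    apply Hd; unfold ball; simpl; unfold AbsRing_ball, abs, minus, plus, opp; simpl.
    rewrite Rabs_pos_eq; lra. }
  assert (HM : exists M, 0 < M /\ forall n, Rabs (c n * (d / 2) ^ n) <= M).
  { assert (Hl : is_lim_seq (fun n => c n * (d / 2) ^ n) 0).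
    { apply ex_series_lim_0; exists (f (t0 + d / 2)).
      revert Hx; apply is_series_ext; intros n.
      rewrite pow_n_pow; unfold scal; simpl; unfold mult; simpl; apply Rmult_comm. }
    apply is_lim_seq_spec in Hl; destruct (Hl (mkposreal 1 Rlt_0_1)) as [N HN].
    destruct (finite_bound N (fun n M => Rabs (c n * (d / 2) ^ n) <= M))
      as [M [HM HMN]].
    { intros n x y Hx' Hxy; lra. }
    { intros n; eexists; apply Rle_refl. }
    exists (M + 1); split; [lra |]; intros n.
    destruct (Compare_dec.le_dec n N) as [Hn | Hn].
    - specialize (HMN n Hn); lra.
    - assert (Hn' : (N <= n)%nat) by lia; specialize (HN n Hn'); simpl in HN.
      rewrite Rminus_0_r in HN; lra. }
  destruct HM as [M [HM Hb]].
  exists (2 / d + M), c.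
  assert (H2 : 0 < 2 / d) by (apply Rdiv_lt_0_compat; lra).
  split; [lra |]; split.
  - intros k; apply Rle_trans with (M * (2 / d) ^ k).
    + specialize (Hb k); rewrite Rabs_mult, (Rabs_pos_eq ((d / 2) ^ k)) in Hb
        by (apply pow_le; lra).
      apply Rmult_le_reg_r with ((d / 2) ^ k); [apply pow_lt; lra |].
      rewrite Rmult_assoc, <- Rpow_mult_distr.
      replace (2 / d * (d / 2)) with 1 by (field; lra).
      rewrite pow1; lra.
    + apply Rmult_le_compat; [lra | apply pow_le; lra | lra | apply pow_incr; lra].
  - intros t Ht; apply Hd.
    unfold ball; simpl; unfold AbsRing_ball, abs, minus, plus, opp; simpl.
    change (Rabs (t - t0) < d).
    assert (H : Rabs (t - t0) * (2 / d) < 1).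
    { eapply Rle_lt_trans; [| exact Ht].
      apply Rmult_le_compat_l; [apply Rabs_pos | lra]. }
    apply (Rmult_lt_compat_r d) in H; [| exact Hp].
    replace (Rabs (t - t0) * (2 / d) * d) with (2 * Rabs (t - t0)) in H by (field; lra).
    pose proof (Rabs_pos (t - t0)); lra.
Qed.

(** Substituting power series into the system determines the coefficient of
    order n + 1 by all those of lower order; the n-th table is correct up to
    order n. *)
Fixpoint coef_table (m : nat) (a : nat -> nat -> nat -> R) (w : nat -> R) (n : nat)
  : nat -> nat -> R :=
  match n with
  | 0%nat => fun _ => w
  | S n' => fun k i =>
      if Nat.leb k n' then coef_table m a w n' k i
      else sum_f_R0 (fun j => PS_mult (a i j) (fun k => coef_table m a w n' k j) n') m
           / INR (S n')
  end.

Definition series_coef m a w (i n : nat) : R := coef_table m a w n n i.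

Lemma coef_table_stable m a w n k i :
  (k <= n)%nat -> coef_table m a w n k i = series_coef m a w i k.
Proof.
  intros Hk; induction n as [| n IH].
  - now replace k with 0%nat by lia.
  - destruct (Nat.eq_dec k (S n)) as [-> | Hn]; [reflexivity |].
    simpl; rewrite (proj2 (Nat.leb_le k n)) by lia; apply IH; lia.
Qed.

Lemma series_coef_S m a w i n :
  INR (S n) * series_coef m a w i (S n) =
  sum_f_R0 (fun j => PS_mult (a i j) (series_coef m a w j) n) m.
Proof.
  unfold series_coef at 1; cbn [coef_table].
  rewrite (proj2 (Nat.leb_gt (S n) n)) by lia.
  field_simplify; [| apply not_0_INR; lia].
  apply sum_eq; intros j _; unfold PS_mult.
  apply sum_eq; intros k Hk; f_equal; apply coef_table_stable; lia.
Qed.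

(** The Cauchy product of order n has n + 1 terms, which the factor n + 1 from
    the derivative compensates; only the number of equations enlarges the
    ratio. *)
Lemma series_coef_bound m a w rho W :
  0 < rho -> 0 <= W ->
  (forall i j k, (i <= m)%nat -> (j <= m)%nat -> Rabs (a i j k) <= rho * rho ^ k) ->
  (forall i, (i <= m)%nat -> Rabs (w i) <= W) ->
  forall n i, (i <= m)%nat ->
    Rabs (series_coef m a w i n) <= W * (rho * INR (S m)) ^ n.
Proof.
  intros Hrho HW Ha Hw.
  set (s := rho * INR (S m)).
  assert (Hs : rho <= s).
  { unfold s; rewrite <- (Rmult_1_r rho) at 1; apply Rmult_le_compat_l; [lra |].
    rewrite S_INR; pose proof (pos_INR m); lra. }
  intros n; induction n as [n IH] using (well_founded_induction lt_wf); intros i Hi.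
  destruct n as [| n].
  - unfold series_coef; simpl; rewrite Rmult_1_r; now apply Hw.
  - assert (HSn : 0 < INR (S n)) by (apply lt_0_INR; lia).
    apply Rmult_le_reg_l with (INR (S n)); [exact HSn |].
    rewrite <- (Rabs_pos_eq (INR (S n))) at 1 by lra.
    rewrite <- Rabs_mult, series_coef_S.
    eapply Rle_trans; [apply Rsum_abs |].
    apply Rle_trans with (sum_f_R0 (fun _ => INR (S n) * (rho * (W * s ^ n))) m).
    + apply sum_Rle; intros j Hj; unfold PS_mult.
      eapply Rle_trans; [apply Rsum_abs |].
      apply Rle_trans with (sum_f_R0 (fun _ => rho * (W * s ^ n)) n).
      * apply sum_Rle; intros k Hk; rewrite Rabs_mult.
        apply Rle_trans with ((rho * s ^ k) * (W * s ^ (n - k))).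
        { apply Rmult_le_compat; try apply Rabs_pos.
          - eapply Rle_trans; [now apply Ha |].
            apply Rmult_le_compat_l; [lra | apply pow_incr; lra].
          - apply IH; [lia | exact Hj]. }
        replace n with (k + (n - k))%nat at 2 by lia.
        rewrite pow_add; apply Req_le; ring.
      * rewrite sum_cte; apply Req_le; ring.
    + rewrite sum_cte; apply Req_le; unfold s; simpl; ring.
Qed.

Lemma is_pseries_sum_f_R0 (c : nat -> nat -> R) (l : nat -> R) m x :
  (forall j, (j <= m)%nat -> is_pseries (c j) x (l j)) ->
  is_pseries (fun n => sum_f_R0 (fun j => c j n) m) x (sum_f_R0 l m).
Proof.
  intros H; induction m as [| m IH]; simpl; [apply (H 0%nat); lia |].
  apply (is_pseries_plus (fun n => sum_f_R0 (fun j => c j n) m) (c (S m))).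
  - apply IH; intros j Hj; apply H; lia.
  - apply H; lia.
Qed.

Lemma power_series_solution m A t0 a w rho :
  0 < rho ->
  (forall i j, (i <= m)%nat -> (j <= m)%nat -> geometric_at rho (A i j) t0 (a i j)) ->
  let s := rho * INR (S m) in
  let z := fun i t => PSeries (series_coef m a w i) (t - t0) in
  (forall i, z i t0 = w i) /\
  (forall t, Rabs (t - t0) * s < 1 ->
     linear_solution m A z t /\
     forall i, (i <= m)%nat -> is_pseries (series_coef m a w i) (t - t0) (z i t)).
Proof.
  intros Hrho Ha s z.
  assert (HSm : 1 <= INR (S m)) by (rewrite S_INR; pose proof (pos_INR m); lra).
  assert (Hs : rho <= s).
  { unfold s; rewrite <- (Rmult_1_r rho) at 1; apply Rmult_le_compat_l; lra. }
  split.
  - intros i; unfold z; rewrite Rminus_diag, PSeries_0; reflexivity.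
  - intros t Ht.
    destruct (finite_bound m (fun i W => Rabs (w i) <= W)) as [W [HW HwW]].
    { intros i x y Hx Hxy; lra. }
    { intros i; eexists; apply Rle_refl. }
    assert (Hcv : forall i, (i <= m)%nat ->
      Rbar_lt (Rabs (t - t0)) (CV_radius (series_coef m a w i))).
    { intros i Hi; apply CV_radius_geometric with W s; [lra | | exact Ht].
      intros n; apply series_coef_bound; auto.
      intros i' j k Hi' Hj; now apply Ha. }
    assert (Hrt : Rabs (t - t0) * rho < 1).
    { eapply Rle_lt_trans; [| exact Ht].
      apply Rmult_le_compat_l; [apply Rabs_pos | exact Hs]. }
    assert (Hz : forall i, (i <= m)%nat ->
      is_pseries (series_coef m a w i) (t - t0) (z i t)).
    { intros i Hi; apply PSeries_correct, CV_radius_inside; now apply Hcv. }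
    split; [| exact Hz].
    intros i Hi.
    replace (linear_field m A z i t)
      with (scal 1 (PSeries (PS_derive (series_coef m a w i)) (t - t0))).
    + apply (is_derive_comp (PSeries (series_coef m a w i)) (fun t => t - t0)).
      * apply is_derive_PSeries; now apply Hcv.
      * auto_derive; [easy | ring].
    + unfold scal; simpl; unfold mult; simpl; rewrite Rmult_1_l.
      apply is_pseries_unique.
      apply (is_pseries_ext
        (fun n => sum_f_R0 (fun j => PS_mult (a i j) (series_coef m a w j) n) m)).
      { intros n; unfold PS_derive; now rewrite series_coef_S. }
      apply (is_pseries_sum_f_R0 (fun j => PS_mult (a i j) (series_coef m a w j))
        (fun j => A i j t * z j t)).
      intros j Hj; apply is_pseries_mult.
      * now apply Ha.
      * now apply Hz.
      * apply CV_radius_geometric with rho rho; [exact Hrho | | exact Hrt].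
        now apply Ha.
      * now apply Hcv.
Qed.

(** The power series with the initial value y(t0) converges to a solution, which
    is y by uniqueness. *)
Lemma linear_solution_analytic m A y :
  (forall i j t, continuity_pt (A i j) t) ->
  (forall t0, exists rho a, 0 < rho /\ forall i j, geometric_at rho (A i j) t0 (a i j)) ->
  (forall t, linear_solution m A y t) ->
  forall i, (i <= m)%nat -> analytic (V := R_NormedModule) (y i).
Proof.
  intros HA Ha Hy i Hi t0.
  destruct (Ha t0) as [rho [a [Hrho Hg]]].
  destruct (power_series_solution m A t0 a (fun j => y j t0) rho Hrho) as [Hz0 Hz];
    [intros; apply Hg |].
  pose (z := fun i t => PSeries (series_coef m a (fun j => y j t0) i) (t - t0)).
  fold z in Hz0, Hz.
  set (s := rho * INR (S m)) in Hz.
  assert (Hs : 0 < s) by (apply Rmult_lt_0_compat; [exact Hrho | apply lt_0_INR; lia]).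
  assert (Hn : forall t, Rabs (t - t0) < / s -> Rabs (t - t0) * s < 1).
  { intros t Ht; apply Rmult_lt_reg_r with (/ s); [now apply Rinv_0_lt_compat |].
    rewrite Rmult_assoc, Rinv_r; lra. }
  assert (Heq : forall t, Rabs (t - t0) < / s -> y i t - z i t = 0).
  { intros t Ht.
    apply (linear_solution_zero m A (fun j t => y j t - z j t) t0 (/ s)); auto.
    - intros u Hu j Hj.
      replace (linear_field _ _ _ _ _)
        with (minus (linear_field m A y j u) (linear_field m A z j u)).
      + apply @is_derive_minus; [now apply Hy | apply Hz; auto].
      + unfold minus, plus, opp; simpl; unfold linear_field.
        rewrite <- Rminus_def, <- minus_sum; apply sum_eq; intros; ring.
    - intros j Hj; change (y j t0 - z j t0 = 0); rewrite (Hz0 j : z j t0 = _); ring. }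
  exists (series_coef m a (fun j => y j t0) i), (mkposreal _ (Rinv_0_lt_compat _ Hs)).
  intros t Ht.
  change (Rabs (t - t0) < / s) in Ht.
  replace (y i t) with (z i t) by (specialize (Heq t Ht); lra).
  apply Hz; auto.
Qed.

Lemma analytic_locally_PSeries (f : R -> R) t0 :
  analytic (V := R_NormedModule) f ->
  exists c, Rbar_lt 0 (CV_radius c) /\ locally t0 (fun t => f t = PSeries c (t - t0)).
Proof.
  intros Hf; destruct (analytic_geometric f t0 Hf) as [rho [c [Hrho [Hc Hs]]]].
  exists c; split.
  - replace (Finite 0) with (Finite (Rabs 0)) by (now rewrite Rabs_R0).
    apply CV_radius_geometric with rho rho; auto; rewrite Rabs_R0; lra.
  - exists (mkposreal _ (Rinv_0_lt_compat _ Hrho)); intros t Ht.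
    change (Rabs (t - t0) < / rho) in Ht.
    symmetry; apply is_pseries_unique, Hs.
    apply Rmult_lt_reg_r with (/ rho); [now apply Rinv_0_lt_compat |].
    rewrite Rmult_assoc, Rinv_r; lra.
Qed.

Lemma analytic_ex_derive_n (f : R -> R) :
  analytic (V := R_NormedModule) f -> forall n t, ex_derive_n f n t.
Proof.
  intros Hf n t; destruct (analytic_locally_PSeries f t Hf) as [c [Hc He]].
  apply (ex_derive_n_ext_loc (fun u => PSeries c (u + - t))).
  { revert He; apply filter_imp; intros u Hu; now rewrite Hu. }
  apply ex_derive_n_comp_trans.
  apply ex_derive_n_PSeries; rewrite Rplus_opp_r, Rabs_R0; exact Hc.
Qed.

Lemma pseries_term (x c : R) n :
  @scal R_AbsRing R_NormedModule (@pow_n R_AbsRing x n) c = x ^ n * c.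
Proof. now rewrite pow_n_pow. Qed.

Lemma analytic_affine (f : R -> R) p q c :
  analytic (V := R_NormedModule) f ->
  analytic (V := R_NormedModule) (fun t => p * f (q * t) + c).
Proof.
  intros Hf t0; destruct (analytic_geometric f (q * t0) Hf) as [rho [a [Hrho [Hc Hs]]]].
  exists (PS_plus (fun n => p * (q ^ n * a n)) (fun n => match n with 0%nat => c | S _ => 0 end)).
  assert (Hq : 0 < rho * (Rabs q + 1))
    by (apply Rmult_lt_0_compat; [exact Hrho | pose proof (Rabs_pos q); lra]).
  exists (mkposreal _ (Rinv_0_lt_compat _ Hq)); intros t Ht.
  change (Rabs (t - t0) < / (rho * (Rabs q + 1))) in Ht.
  apply (@is_pseries_plus R_AbsRing R_NormedModule _ _ (t - t0) (p * f (q * t)) c).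
  - assert (H : is_pseries a (q * t - q * t0) (f (q * t))).
    { apply Hs; rewrite <- Rmult_minus_distr_l, Rabs_mult.
      apply Rmult_lt_compat_r with (r := rho * (Rabs q + 1)) in Ht; [| exact Hq].
      rewrite Rinv_l in Ht by lra.
      pose proof (Rabs_pos (t - t0)); nra. }
    apply (@is_pseries_scal R_AbsRing R_NormedModule p (fun n => q ^ n * a n) (t - t0) (f (q * t)));
      [apply Rmult_comm |].
    revert H; apply is_series_ext; intros n.
    rewrite !pseries_term, <- Rmult_minus_distr_l, Rpow_mult_distr.
    change (q ^ n * (t - t0) ^ n * a n = (t - t0) ^ n * (q ^ n * a n)); ring.
  - apply (filterlim_ext (fun _ => c)); [| apply filterlim_const].
    intros n; induction n as [| n IH].
    + rewrite sum_O, pseries_term; symmetry; apply Rmult_1_l.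
    + rewrite sum_Sn, <- IH, pseries_term, Rmult_0_r; symmetry; apply Rplus_0_r.
Qed.

Lemma analytic_translate {V : NormedModule R_AbsRing} (f : R -> V) s :
  analytic f -> analytic (fun t => f (t + s)).
Proof.
  intros Hf t0; destruct (Hf (t0 + s)) as [c [d Hd]].
  exists c, d; intros t Ht.
  replace (t - t0) with (t + s - (t0 + s)) by ring.
  apply Hd; change (Rabs (t - t0) < d) in Ht.
  change (Rabs (t + s - (t0 + s)) < d).
  now replace (t + s - (t0 + s)) with (t - t0) by ring.
Qed.

Lemma analytic_scal {V : NormedModule R_AbsRing} (f : R -> V) (k : R) :
  analytic f -> analytic (fun t => scal k (f t)).
Proof.
  intros Hf t0; destruct (Hf t0) as [c Hc]; exists (PS_scal k c).
  revert Hc; apply filter_imp; intros t Ht.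
  apply (@is_pseries_scal R_AbsRing V k c (t - t0) (f t)); [apply Rmult_comm | exact Ht].
Qed.

(** * Calculus in Euclidean space *)

Lemma dot_comm u v : dot u v = dot v u.
Proof. unfold dot; ring. Qed.

Lemma norm_E3 (u : E3) : norm u = sqrt (dot u u).
Proof.
  unfold norm; simpl; unfold prod_norm; simpl; unfold prod_norm, norm; simpl.
  unfold abs; simpl; unfold dot, Defs.c1, c2, c3.
  f_equal; unfold prod_norm, norm; simpl; unfold abs; simpl.
  rewrite !Rmult_1_r, sqrt_sqrt.
  - rewrite <- !Rabs_mult, !Rabs_pos_eq by apply Rle_0_sqr; reflexivity.
  - apply Rplus_le_le_0_compat; apply Rle_0_sqr || (rewrite <- Rabs_mult; apply Rabs_pos).
Qed.

Lemma dot_self_pos u : 0 <= dot u u.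
Proof. unfold dot; nra. Qed.

Lemma norm_eq_1 (u : E3) : norm u = 1 <-> dot u u = 1.
Proof.
  rewrite norm_E3; split; intros H.
  - rewrite <- (sqrt_sqrt (dot u u)), H by apply dot_self_pos; ring.
  - rewrite H; apply sqrt_1.
Qed.

Lemma E3_ext (u v : E3) : Defs.c1 u = Defs.c1 v -> c2 u = c2 v -> c3 u = c3 v -> u = v.
Proof.
  destruct u as [[u1 u2] u3], v as [[v1 v2] v3].
  unfold Defs.c1, c2, c3; simpl; now intros -> -> ->.
Qed.

Lemma is_linear_c1 : is_linear (Defs.c1 : E3 -> R).
Proof.
  apply (is_linear_comp (V := prod_NormedModule _ R_NormedModule R_NormedModule) fst fst);
    apply is_linear_fst.
Qed.

Lemma is_linear_c2 : is_linear (c2 : E3 -> R).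
Proof.
  apply (is_linear_comp (V := prod_NormedModule _ R_NormedModule R_NormedModule) fst snd);
    [apply is_linear_fst | apply is_linear_snd].
Qed.

Lemma is_linear_c3 : is_linear (c3 : E3 -> R).
Proof. apply is_linear_snd. Qed.

Lemma is_derive_linear {V W : NormedModule R_AbsRing} (g : V -> W) (f : R -> V) t l :
  is_linear g -> is_derive f t l -> is_derive (fun s => g (f s)) t (g l).
Proof.
  intros Hg Hf; unfold is_derive.
  apply (filterdiff_ext_lin _ (fun s : R_AbsRing => g (scal s l))).
  - apply (filterdiff_comp' f g t (fun s : R_AbsRing => scal s l) g); [exact Hf |].
    now apply filterdiff_linear.
  - intros s; apply (linear_scal g Hg).
Qed.

Lemma is_derive_E3 (f : R -> E3) t l :
  is_derive f t l <->
  is_derive (fun s => Defs.c1 (f s)) t (Defs.c1 l) /\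
  is_derive (fun s => c2 (f s)) t (c2 l) /\
  is_derive (fun s => c3 (f s)) t (c3 l).
Proof.
  split.
  - intros H; split; [| split].
    + exact (is_derive_linear _ f t l is_linear_c1 H).
    + exact (is_derive_linear _ f t l is_linear_c2 H).
    + exact (is_derive_linear _ f t l is_linear_c3 H).
  - intros [H1 [H2 H3]].
    assert (E : forall u : E3, plus (plus (scal (Defs.c1 u) ((1, 0, 0) : E3))
      (scal (c2 u) ((0, 1, 0) : E3))) (scal (c3 u) ((0, 0, 1) : E3)) = u).
    { intros u; apply E3_ext; unfold Defs.c1, c2, c3;
        simpl; unfold plus, scal; simpl; unfold mult; simpl; ring. }
    rewrite <- (E l).
    apply (is_derive_ext (fun s => plus (plus (scal (Defs.c1 (f s)) ((1, 0, 0) : E3))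
      (scal (c2 (f s)) ((0, 1, 0) : E3))) (scal (c3 (f s)) ((0, 0, 1) : E3)))).
    { intros s; apply E. }
    apply @is_derive_plus; [apply @is_derive_plus |];
      apply @is_derive_scal_l; assumption.
Qed.

Lemma is_derive_c1 (f : R -> E3) t l :
  is_derive f t l -> is_derive (fun s => Defs.c1 (f s)) t (Defs.c1 l).
Proof. intros H; now apply is_derive_E3 in H. Qed.

Lemma is_derive_c2 (f : R -> E3) t l :
  is_derive f t l -> is_derive (fun s => c2 (f s)) t (c2 l).
Proof. intros H; now apply is_derive_E3 in H. Qed.

Lemma is_derive_c3 (f : R -> E3) t l :
  is_derive f t l -> is_derive (fun s => c3 (f s)) t (c3 l).
Proof. intros H; now apply is_derive_E3 in H. Qed.

Lemma is_derive_dot (f g : R -> E3) t df dg :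
  is_derive f t df -> is_derive g t dg ->
  is_derive (fun s => dot (f s) (g s)) t (dot df (g t) + dot (f t) dg).
Proof.
  intros Hf Hg; apply is_derive_E3 in Hf as [F1 [F2 F3]].
  apply is_derive_E3 in Hg as [G1 [G2 G3]].
  unfold dot.
  replace (_ + _) with
    ((Defs.c1 df * Defs.c1 (g t) + Defs.c1 (f t) * Defs.c1 dg) +
     (c2 df * c2 (g t) + c2 (f t) * c2 dg) +
     (c3 df * c3 (g t) + c3 (f t) * c3 dg)) by ring.
  apply @is_derive_plus; [apply @is_derive_plus |];
    apply @is_derive_mult; try assumption; intros; apply Rmult_comm.
Qed.

Lemma is_pseries_pair {V W : NormedModule R_AbsRing} (a : nat -> V) (b : nat -> W)
  (x : R) (l : V) (l' : W) :
  is_pseries a x l -> is_pseries b x l' ->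
  @is_pseries R_AbsRing (prod_NormedModule R_AbsRing V W) (fun n => (a n, b n)) x (l, l').
Proof.
  intros Ha Hb.
  apply (filterlim_ext (fun n => (sum_n (fun k => scal (pow_n x k) (a k)) n,
    sum_n (fun k => scal (pow_n x k) (b k)) n))).
  - intros n; induction n as [| n IH]; [now rewrite !sum_O |].
    now rewrite !sum_Sn, <- IH.
  - intros P [d Hd].
    destruct (Ha _ (locally_ball l d)) as [N1 H1].
    destruct (Hb _ (locally_ball l' d)) as [N2 H2].
    exists (Nat.max N1 N2); intros n Hn; apply Hd.
    split; [apply H1 | apply H2]; lia.
Qed.

Lemma analytic_pair {V W : NormedModule R_AbsRing} (f : R -> V) (g : R -> W) :
  analytic f -> analytic g ->
  analytic (V := prod_NormedModule R_AbsRing V W) (fun t => (f t, g t)).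
Proof.
  intros Hf Hg t0; destruct (Hf t0) as [a Ha], (Hg t0) as [b Hb].
  exists (fun n => (a n, b n)).
  generalize (filter_and _ _ Ha Hb); apply filter_imp; intros t [H1 H2].
  now apply is_pseries_pair.
Qed.

(** Replaces Leibniz formulas: it suffices to find a family of functions that
    is stable under differentiation. *)
Lemma smooth_of_derive_closed (F : (R -> R) -> Prop) :
  (forall f, F f -> exists g, F g /\ forall t, is_derive f t (g t)) ->
  forall f, F f -> forall n t, ex_derive_n f n t.
Proof.
  intros HF.
  assert (H : forall n f, F f -> exists g, F g /\ forall t, Derive_n f n t = g t).
  { intros n; induction n as [| n IH]; intros f Hf; [now exists f |].
    destruct (IH f Hf) as [g [Hg E]], (HF g Hg) as [h [Hh Hd]].
    exists h; split; [exact Hh |]; intros t; simpl.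
    rewrite (Derive_ext _ g) by exact E; now apply is_derive_unique. }
  intros f Hf [| n] t; simpl; [exact I |].
  destruct (H n f Hf) as [g [Hg E]], (HF g Hg) as [h [_ Hd]].
  apply (ex_derive_ext g); [intros s; now rewrite E |].
  now exists (h t).
Qed.

(** * Existence of the Frenet frame *)

Lemma is_derive_eq (f : R -> R) t (l l' : R) : is_derive f t l -> l = l' -> is_derive f t l'.
Proof. now intros H <-. Qed.

Ltac derive_subst :=
  repeat match goal with
  | H : is_derive ?f ?t ?l |- context [Derive ?g ?t'] =>
      replace (Derive g t') with l by (symmetry; exact (is_derive_unique f t l H))
  end.

Lemma is_derive_zero_const (f : R -> R) :
  (forall t, is_derive f t 0) -> forall s t, f s = f t.
Proof.
  intros H s t; destruct (Rtotal_order s t) as [L | [-> | L]].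
  - apply (eq_is_derive f s t); auto; intros u _; apply H.
  - reflexivity.
  - symmetry; apply (eq_is_derive f t s); auto; intros u _; apply H.
Qed.

Lemma is_derive_cross (f g : R -> E3) t df dg :
  is_derive f t df -> is_derive g t dg ->
  is_derive (fun s => cross (f s) (g s)) t (plus (cross df (g t)) (cross (f t) dg)).
Proof.
  intros Hf Hg; apply is_derive_E3 in Hf as [F1 [F2 F3]].
  apply is_derive_E3 in Hg as [G1 [G2 G3]].
  assert (M : forall p q dp dq p' q' dp' dq' : R, forall u v u' v' : R -> R,
    is_derive u t dp -> is_derive v t dq -> is_derive u' t dp' -> is_derive v' t dq' ->
    u t = p -> v t = q -> u' t = p' -> v' t = q' ->
    is_derive (fun s => u s * v s - u' s * v' s) t
      ((dp * q - dp' * q') + (p * dq - p' * dq'))).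
  { intros p q dp dq p' q' dp' dq' u v u' v' U V U' V' <- <- <- <-.
    replace (_ + _) with
      (minus (dp * v t + u t * dq) (dp' * v' t + u' t * dq'))
      by (unfold minus, plus, opp; simpl; ring).
    apply @is_derive_minus; apply @is_derive_mult; try assumption;
      intros; apply Rmult_comm. }
  apply is_derive_E3; split; [| split].
  - now apply M.
  - now apply M.
  - now apply M.
Qed.

Definition frenet_at (kappa tau : R -> R) (T N B : R -> E3) (t : R) : Prop :=
  is_derive T t (scal (kappa t) (N t)) /\
  is_derive N t (plus (scal (- kappa t) (T t)) (scal (tau t) (B t))) /\
  is_derive B t (scal (- tau t) (N t)).

Ltac E3_ring :=
  unfold dot, cross, plus, scal, minus, opp, zero, Defs.c1, c2, c3; simpl;
  unfold prod_plus, prod_scal, prod_opp, prod_zero; simpl;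
  unfold plus, scal, opp, zero; simpl; unfold mult; simpl; ring.

Lemma dot_plus_l u v w : dot (plus u v) w = dot u w + dot v w.
Proof. E3_ring. Qed.
Lemma dot_plus_r u v w : dot u (plus v w) = dot u v + dot u w.
Proof. E3_ring. Qed.
Lemma dot_minus_l u v w : dot (minus u v) w = dot u w - dot v w.
Proof. E3_ring. Qed.
Lemma dot_minus_r u v w : dot u (minus v w) = dot u v - dot u w.
Proof. E3_ring. Qed.
Lemma dot_scal_l (k : R) u v : dot (scal k u) v = k * dot u v.
Proof. E3_ring. Qed.
Lemma dot_scal_r (k : R) u v : dot u (scal k v) = k * dot u v.
Proof. E3_ring. Qed.

(** The Frenet matrix is skew, so the squared distance of the Gram matrix of
    (T, N, B) from the identity is conserved. *)
Lemma frenet_orthonormal kappa tau T N B t0 :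
  (forall t, frenet_at kappa tau T N B t) ->
  dot (T t0) (T t0) = 1 -> dot (N t0) (N t0) = 1 -> dot (B t0) (B t0) = 1 ->
  dot (T t0) (N t0) = 0 -> dot (T t0) (B t0) = 0 -> dot (N t0) (B t0) = 0 ->
  forall t, dot (T t) (T t) = 1 /\ dot (N t) (N t) = 1 /\ dot (B t) (B t) = 1 /\
    dot (T t) (N t) = 0 /\ dot (T t) (B t) = 0 /\ dot (N t) (B t) = 0.
Proof.
  intros HF TT0 NN0 BB0 TN0 TB0 NB0 t.
  set (TT := fun t => dot (T t) (T t)); set (NN := fun t => dot (N t) (N t)).
  set (BB := fun t => dot (B t) (B t)); set (TN := fun t => dot (T t) (N t)).
  set (TB := fun t => dot (T t) (B t)); set (NB := fun t => dot (N t) (B t)).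
  assert (D : forall s,
    is_derive TT s (2 * kappa s * TN s) /\
    is_derive NN s (2 * (tau s * NB s - kappa s * TN s)) /\
    is_derive BB s (- 2 * tau s * NB s) /\
    is_derive TN s (kappa s * NN s - kappa s * TT s + tau s * TB s) /\
    is_derive TB s (kappa s * NB s - tau s * TN s) /\
    is_derive NB s (- kappa s * TB s + tau s * BB s - tau s * NN s)).
  { intros s; destruct (HF s) as [DT [DN DB]].
    unfold TT, NN, BB, TN, TB, NB.
    refine (conj _ (conj _ (conj _ (conj _ (conj _ _))))).
    all: eapply is_derive_eq; [eapply is_derive_dot; eassumption |].
    all: rewrite ?dot_plus_l, ?dot_plus_r, ?dot_scal_l, ?dot_scal_r,
      ?(dot_comm (N s) (T s)), ?(dot_comm (B s) (T s)), ?(dot_comm (B s) (N s)); ring. }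
  set (Q := fun t => (TT t - 1) ^ 2 + (NN t - 1) ^ 2 + (BB t - 1) ^ 2
    + 2 * TN t ^ 2 + 2 * TB t ^ 2 + 2 * NB t ^ 2).
  assert (HQ : forall s, is_derive Q s 0).
  { intros s; destruct (D s) as [D1 [D2 [D3 [D4 [D5 D6]]]]]; unfold Q.
    auto_derive; [repeat split; eexists; eassumption |].
    derive_subst; ring. }
  assert (E : Q t = 0).
  { rewrite (is_derive_zero_const Q HQ t t0); unfold Q, TT, NN, BB, TN, TB, NB.
    rewrite TT0, NN0, BB0, TN0, TB0, NB0; ring. }
  unfold Q in E.
  pose proof (pow2_ge_0 (TT t - 1)); pose proof (pow2_ge_0 (NN t - 1));
  pose proof (pow2_ge_0 (BB t - 1)); pose proof (pow2_ge_0 (TN t));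
  pose proof (pow2_ge_0 (TB t)); pose proof (pow2_ge_0 (NB t)).
  assert (Z : forall x : R, x ^ 2 <= 0 -> x = 0) by (intros x Hx; nra).
  fold (TT t) (NN t) (BB t) (TN t) (TB t) (NB t).
  repeat split; try (apply Rminus_diag_uniq); apply Z; lra.
Qed.

(** The determinant of the frame is conserved, so B and T x N are unit vectors
    with inner product 1. *)
Lemma frenet_cross kappa tau T N B t0 :
  (forall t, frenet_at kappa tau T N B t) ->
  (forall t, dot (T t) (T t) = 1 /\ dot (N t) (N t) = 1 /\ dot (B t) (B t) = 1 /\
    dot (T t) (N t) = 0 /\ dot (T t) (B t) = 0 /\ dot (N t) (B t) = 0) ->
  B t0 = cross (T t0) (N t0) ->
  forall t, B t = cross (T t) (N t).
Proof.
  intros HF HO H0 t.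
  assert (Hdet : dot (B t) (cross (T t) (N t)) = 1).
  { transitivity (dot (B t0) (cross (T t0) (N t0)));
      [| rewrite <- H0; apply (HO t0)].
    apply (is_derive_zero_const (fun s => dot (B s) (cross (T s) (N s)))).
    intros s; destruct (HF s) as [DT [DN DB]].
    replace 0 with (dot (scal (- tau s) (N s)) (cross (T s) (N s)) +
      dot (B s) (plus (cross (scal (kappa s) (N s)) (N s))
        (cross (T s) (plus (scal (- kappa s) (T s)) (scal (tau s) (B s)))))) by E3_ring.
    apply is_derive_dot; [exact DB |]; now apply is_derive_cross. }
  destruct (HO t) as [TT [NN [BB [TN _]]]].
  assert (Hcc : dot (cross (T t) (N t)) (cross (T t) (N t)) = 1).
  { replace 1 with (dot (T t) (T t) * dot (N t) (N t) - dot (T t) (N t) ^ 2)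
      by (rewrite TT, NN, TN; ring).
    E3_ring. }
  assert (Hd : dot (minus (B t) (cross (T t) (N t))) (minus (B t) (cross (T t) (N t))) = 0).
  { rewrite dot_minus_l, !dot_minus_r, (dot_comm (cross (T t) (N t)) (B t)), BB, Hdet, Hcc; ring. }
  set (u := cross (T t) (N t)) in *; clearbody u.
  assert (Z : forall x y z : R, x * x + y * y + z * z = 0 -> x = 0 /\ y = 0 /\ z = 0)
    by (intros; nra).
  apply Z in Hd; destruct Hd as [H1 [H2 H3]].
  apply E3_ext; apply Rminus_diag_uniq; assumption.
Qed.

Definition frenet_matrix (kappa tau : R -> R) (i j : nat) : R -> R :=
  match i, j with
  | 0%nat, 1%nat => kappa
  | 1%nat, 0%nat => fun t => - kappa t
  | 1%nat, 2%nat => tau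
  | 2%nat, 1%nat => fun t => - tau t
  | _, _ => fun _ => 0
  end.

Lemma analytic_continuity (f : R -> R) :
  analytic (V := R_NormedModule) f -> forall t, continuity_pt f t.
Proof.
  intros Hf t; destruct (analytic_ex_derive_n f Hf 1 t) as [l Hl].
  now apply is_derive_continuity_pt with l.
Qed.

Lemma geometric_at_opp rho f t0 c :
  geometric_at rho f t0 c -> geometric_at rho (fun t => - f t) t0 (fun k => - c k).
Proof.
  intros [Hc Hs]; split.
  - intros k; rewrite Rabs_Ropp; apply Hc.
  - intros t Ht; apply (is_pseries_opp c); now apply Hs.
Qed.

Lemma geometric_at_0 rho t0 : 0 <= rho -> geometric_at rho (fun _ => 0) t0 (fun _ => 0).
Proof.
  intros Hr; split.
  - intros k; rewrite Rabs_R0; apply Rmult_le_pos; [exact Hr | now apply pow_le].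
  - intros t _.
    apply (filterlim_ext (fun _ => 0)); [| apply filterlim_const].
    intros n; induction n as [| n IH].
    + rewrite sum_O, pseries_term; symmetry; apply Rmult_0_r.
    + rewrite sum_Sn, <- IH, pseries_term, Rmult_0_r; symmetry; apply Rplus_0_r.
Qed.

(** The coordinates of the frame along each of the three axes solve the same
    system; the initial values are the rows of the identity matrix. *)
Lemma frenet_frame_exists (kappa tau : R -> R) :
  analytic (V := R_NormedModule) kappa -> analytic (V := R_NormedModule) tau ->
  exists T N B : R -> E3,
    (analytic T /\ analytic N /\ analytic B) /\
    (forall t, frenet_at kappa tau T N B t) /\
    (forall t, dot (T t) (T t) = 1 /\ dot (N t) (N t) = 1 /\ dot (B t) (B t) = 1 /\
      dot (T t) (N t) = 0 /\ dot (T t) (B t) = 0 /\ dot (N t) (B t) = 0) /\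
    (forall t, B t = cross (T t) (N t)).
Proof.
  intros Hk Ht.
  set (A := frenet_matrix kappa tau).
  assert (HA : forall i j t, continuity_pt (A i j) t).
  { pose proof (analytic_continuity _ Hk); pose proof (analytic_continuity _ Ht).
    assert (C0 : forall t, continuity_pt (fun _ => 0) t)
      by (intros t; apply continuity_pt_const; now intros ? ?).
    intros i j t; destruct i as [| [| [| i]]], j as [| [| [| j]]]; simpl; auto;
      [apply (continuity_pt_opp kappa) | apply (continuity_pt_opp tau)]; auto. }
  assert (Ha : forall t0, exists rho a, 0 < rho /\
    forall i j, geometric_at rho (A i j) t0 (a i j)).
  { intros t0.
    destruct (analytic_geometric kappa t0 Hk) as [r1 [a1 [R1 G1]]].
    destruct (analytic_geometric tau t0 Ht) as [r2 [a2 [R2 G2]]].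
    apply (geometric_at_le r1 (r1 + r2)) in G1; [| lra | lra].
    apply (geometric_at_le r2 (r1 + r2)) in G2; [| lra | lra].
    exists (r1 + r2), (fun i j => match i, j with
      | 0%nat, 1%nat => a1 | 1%nat, 0%nat => fun k => - a1 k
      | 1%nat, 2%nat => a2 | 2%nat, 1%nat => fun k => - a2 k
      | _, _ => fun _ => 0 end); split; [lra |].
    assert (G0 : geometric_at (r1 + r2) (fun _ => 0) t0 (fun _ => 0))
      by (apply geometric_at_0; lra).
    intros i j; destruct i as [| [| [| i]]], j as [| [| [| j]]]; simpl; auto;
      now apply geometric_at_opp. }
  assert (Hsol : forall d, exists y : nat -> R -> R, (forall t, linear_solution 2 A y t) /\
    (forall i, (i <= 2)%nat -> analytic (V := R_NormedModule) (y i)) /\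
    (forall i, (i <= 2)%nat -> y i 0 = if Nat.eqb i d then 1 else 0)).
  { intros d.
    destruct (linear_solution_exists 2 A (fun i => if Nat.eqb i d then 1 else 0) HA)
      as [y [Hy H0]].
    exists y; split; [exact Hy | split; [| exact H0]].
    now apply (linear_solution_analytic 2 A). }
  destruct (Hsol 0%nat) as [x1 [S1 [A1 I1]]], (Hsol 1%nat) as [x2 [S2 [A2 I2]]],
    (Hsol 2%nat) as [x3 [S3 [A3 I3]]].
  set (row := fun (i : nat) (t : R) => ((x1 i t, x2 i t, x3 i t) : E3)).
  assert (HF : forall t, frenet_at kappa tau (row 0%nat) (row 1%nat) (row 2%nat) t).
  { intros t; unfold frenet_at.
    assert (R : forall i l, (i <= 2)%nat ->
      l = ((linear_field 2 A x1 i t, linear_field 2 A x2 i t, linear_field 2 A x3 i t) : E3) ->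
      is_derive (row i) t l).
    { intros i l Hi ->; apply is_derive_E3; split; [| split].
      - now apply S1.
      - now apply S2.
      - now apply S3. }
    split; [| split]; apply R; auto; unfold linear_field, A, row; simpl;
      apply E3_ext; E3_ring. }
  exists (row 0%nat), (row 1%nat), (row 2%nat).
  split; [| split; [exact HF |]].
  { assert (R : forall i, (i <= 2)%nat -> analytic (row i)).
    { intros i Hi.
      apply (analytic_pair (V := prod_NormedModule R_AbsRing R_NormedModule R_NormedModule)
        (W := R_NormedModule) (fun t => (x1 i t, x2 i t)) (x3 i)); [| now apply A3].
      apply analytic_pair; [now apply A1 | now apply A2]. }
    repeat split; apply R; auto. }
  assert (R0 : row 0%nat 0 = (1, 0, 0) /\ row 1%nat 0 = (0, 1, 0) /\ row 2%nat 0 = (0, 0, 1)).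
  { unfold row; rewrite !I1, !I2, !I3 by auto; simpl; auto. }
  destruct R0 as [T0 [N0 B0]].
  assert (HO := fun H1 H2 H3 H4 H5 H6 =>
    frenet_orthonormal kappa tau _ _ _ 0 HF H1 H2 H3 H4 H5 H6).
  rewrite T0, N0, B0 in HO.
  specialize (HO ltac:(E3_ring) ltac:(E3_ring) ltac:(E3_ring) ltac:(E3_ring)
    ltac:(E3_ring) ltac:(E3_ring)).
  split; [exact HO |].
  apply (frenet_cross kappa tau _ _ _ 0 HF HO).
  rewrite T0, N0, B0; apply E3_ext; E3_ring.
Qed.

(** * Curvature and torsion functions of geodesics *)

Definition geodesic_data (a b : R) (k k1 tau tau1 : R -> R) : Prop :=
  forall t,
    is_derive k t (k1 t) /\
    is_derive k1 t (k t * (tau t * (tau t - b) + (1 + a ^ 2 - k t ^ 2) / 2)) /\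
    is_derive tau t (tau1 t) /\
    k t ^ 2 * (2 * tau t - b) = b * (a ^ 2 - 1) /\
    k1 t ^ 2 + 1 / 4 * (1 + a ^ 2 - k t ^ 2) ^ 2 + k t ^ 2 * (tau t - b) ^ 2
      = a ^ 2 + b ^ 2.

Lemma geodesic_data_of_equations a b kappa tau :
  analytic (V := R_NormedModule) kappa -> analytic (V := R_NormedModule) tau ->
  geodesic_equations a b kappa tau ->
  geodesic_data a b kappa (Derive kappa) tau (Derive tau).
Proof.
  intros Hk Ht H t; destruct (H t) as [H1 [H2 H3]].
  split; [| split; [| split; [| split; assumption]]].
  - apply Derive_correct, (analytic_ex_derive_n kappa Hk 1).
  - rewrite <- H1; apply Derive_correct, (analytic_ex_derive_n kappa Hk 2).
  - apply Derive_correct, (analytic_ex_derive_n tau Ht 1).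
Qed.

Lemma geodesic_equations_of_data a b k k1 tau tau1 :
  geodesic_data a b k k1 tau tau1 -> geodesic_equations a b k tau.
Proof.
  intros H t; destruct (H t) as [H1 [H2 [_ [H4 H5]]]].
  assert (E : forall s, Derive k s = k1 s)
    by (intros s; apply is_derive_unique; apply (H s)).
  split; [| split; [exact H4 |]].
  - simpl; rewrite (Derive_ext _ k1) by exact E; now apply is_derive_unique.
  - now rewrite E.
Qed.

Lemma geodesic_data_translate a b k k1 tau tau1 s :
  geodesic_data a b k k1 tau tau1 ->
  geodesic_data a b (fun t => k (t + s)) (fun t => k1 (t + s))
    (fun t => tau (t + s)) (fun t => tau1 (t + s)).
Proof.
  intros H t; destruct (H (t + s)) as [H1 [H2 [H3 H4]]].
  assert (D : forall (f : R -> R) (l : R), is_derive f (t + s) l ->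
    is_derive (fun t => f (t + s)) t l).
  { intros f l Hf; replace l with (scal 1 l) by apply Rmult_1_l.
    apply (is_derive_comp f (fun t => t + s)); [exact Hf |].
    auto_derive; [easy | ring]. }
  split; [| split; [| split; [| exact H4]]]; now apply D.
Qed.

Lemma geodesic_data_torsion_shift a b k k1 tau tau1 :
  0 < a -> geodesic_data a b k k1 tau tau1 ->
  geodesic_data (1 / a) (- (b / a))
    (fun t => 1 / a * k (t / a)) (fun t => (1 / a) ^ 2 * k1 (t / a))
    (fun t => 1 / a * tau (t / a) - b / a) (fun t => (1 / a) ^ 2 * tau1 (t / a)).
Proof.
  intros Ha H t; destruct (H (t / a)) as [H1 [H2 [H3 [H4 H5]]]].
  assert (D : forall (f : R -> R) (l p q : R), is_derive f (t / a) l ->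
    is_derive (fun t => p * f (t / a) - q) t (p * (1 / a) * l)).
  { intros f l p q Hf.
    auto_derive; [now exists l |].
    change (Derive (fun x => f x) (t * / a)) with (Derive f (t / a)).
    rewrite (is_derive_unique f _ l Hf); field; lra. }
  assert (D' : forall (f : R -> R) (l p : R), is_derive f (t / a) l ->
    is_derive (fun t => p * f (t / a)) t (p * (1 / a) * l)).
  { intros f l p Hf; apply (is_derive_ext (fun t => p * f (t / a) - 0)).
    { intros; apply Rminus_0_r. }
    now apply D. }
  split; [| split; [| split; [| split]]].
  - apply (is_derive_eq _ _ _ _ (D' _ _ _ H1)); ring.
  - apply (is_derive_eq _ _ _ _ (D' _ _ _ H2)); field; lra.
  - apply (is_derive_eq _ _ _ _ (D _ _ _ _ H3)); ring.
  - replace (_ * _) with (k (t / a) ^ 2 * (2 * tau (t / a) - b) * (1 / a) ^ 3)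
      by (field; lra).
    rewrite H4; field; lra.
  - set (x := t / a) in *.
    (* The first integral of the new equations is 1/a^4 times the old one, up to
       a multiple of the algebraic relation. *)
    replace (_ + _ + _) with
      ((1 / a) ^ 4 * ((k1 x ^ 2 + 1 / 4 * (1 + a ^ 2 - k x ^ 2) ^ 2
         + k x ^ 2 * (tau x - b) ^ 2) + b * (k x ^ 2 * (2 * tau x - b)))) by (field; lra).
    rewrite H4, H5; field; lra.
Qed.

Lemma second_order_zero (e e1 g : R -> R) t0 :
  (forall t, continuity_pt g t) ->
  (forall t, is_derive e t (e1 t)) ->
  (forall t, is_derive e1 t (g t * e t)) ->
  e t0 = 0 -> e1 t0 = 0 -> forall t, e t = 0.
Proof.
  intros Hg He He1 E0 E1 t.
  apply (linear_solution_zero 1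
    (fun i j => match i, j with
                | 0%nat, 1%nat => fun _ => 1 | 1%nat, 0%nat => g | _, _ => fun _ => 0 end)
    (fun i => match i with 0%nat => e | _ => e1 end) t0 (Rabs (t - t0) + 1)) with (i := 0%nat).
  - assert (C : forall c s, continuity_pt (fun _ => c) s)
      by (intros c s; apply continuity_pt_const; now intros ? ?).
    intros i j s; destruct i as [| [| i]], j as [| [| j]]; auto.
  - intros s _ i Hi; destruct i as [| [| i]]; unfold linear_field; simpl.
    + apply (is_derive_eq _ _ _ _ (He s)); ring.
    + apply (is_derive_eq _ _ _ _ (He1 s)); ring.
    + lia.
  - intros i Hi; destruct i as [| i]; assumption.
  - lia.
  - lra.
Qed.

Lemma curvature_zero a b k k1 tau tau1 t0 :
  geodesic_data a b k k1 tau tau1 -> k t0 = 0 -> k1 t0 = 0 -> forall t, k t = 0.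
Proof.
  intros H K0 K1.
  apply (second_order_zero k k1
    (fun t => tau t * (tau t - b) + (1 + a ^ 2 - k t ^ 2) / 2) t0); auto.
  - intros t; destruct (H t) as [H1 [_ [H3 _]]].
    eapply is_derive_continuity_pt.
    auto_derive; [repeat split; eexists; eassumption |].
    reflexivity.
  - intros t; apply (H t).
  - intros t; apply (is_derive_eq _ _ _ _ (proj1 (proj2 (H t)))); ring.
Qed.

(** Where [k] vanishes, the constant b (a^2 - 1) of the algebraic relation is zero.
    Since k' <> 0 there, k has no other zero nearby, so that 2 tau = b around it. *)
Lemma torsion_at_inflection a b k k1 tau tau1 t :
  geodesic_data a b k k1 tau tau1 -> k t = 0 -> k1 t <> 0 -> 2 * tau t - b = 0.
Proof.
  intros H K K1.
  destruct (Req_dec (2 * tau t - b) 0) as [E | E]; [exact E | exfalso; apply K1].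
  destruct (H t) as [H1 [_ [H3 [H4 _]]]].
  rewrite <- (is_derive_unique _ _ _ H1), <- (Derive_const 0 t).
  apply Derive_ext_loc.
  assert (C : continuity_pt (fun s => 2 * tau s - b) t).
  { eapply is_derive_continuity_pt; auto_derive; [now exists (tau1 t) | reflexivity]. }
  assert (L : locally t (fun s => 2 * tau s - b <> 0)).
  { apply continuity_pt_filterlim in C.
    apply (C (fun y => y <> 0)), open_neq, E. }
  revert L; apply filter_imp; intros s Hs.
  destruct (H s) as [_ [_ [_ [H4' _]]]].
  assert (Z : k s ^ 2 * (2 * tau s - b) = 0) by (rewrite H4', <- H4, K; ring).
  apply Rmult_integral in Z; destruct Z as [Z | Z]; [nra | contradiction].
Qed.

(** The derivative of the algebraic relation is this equation multiplied by 2 k;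
    where k vanishes, either k' = 0 or the torsion is b/2. *)
Lemma torsion_derivative a b k k1 tau tau1 t :
  geodesic_data a b k k1 tau tau1 -> k1 t * (2 * tau t - b) + k t * tau1 t = 0.
Proof.
  intros H; destruct (H t) as [H1 [_ [H3 _]]].
  assert (Z : 2 * k t * (k1 t * (2 * tau t - b) + k t * tau1 t) = 0).
  { assert (D : is_derive (fun s => k s ^ 2 * (2 * tau s - b)) t
      (2 * k t * (k1 t * (2 * tau t - b) + k t * tau1 t))).
    { auto_derive; [split; [now exists (k1 t) | split; [now exists (tau1 t) | easy]] |].
      derive_subst; ring. }
    rewrite <- (is_derive_unique _ _ _ D), <- (Derive_const (b * (a ^ 2 - 1)) t).
    apply Derive_ext; intros s; apply (H s). }
  destruct (Req_dec (k t) 0) as [K | K]; [| apply Rmult_integral in Z; lra].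
  rewrite K, Rmult_0_l, Rplus_0_r.
  destruct (Req_dec (k1 t) 0) as [-> | K1]; [ring |].
  rewrite (torsion_at_inflection a b k k1 tau tau1 t H K K1); ring.
Qed.

(** Multiply the first integral by 4 k^2 and eliminate k^2 (tau - b) by the
    algebraic relation: the resulting cubic in k^2 happens to factor. *)
Lemma curvature_square_first_integral a b k k1 tau tau1 t :
  geodesic_data a b k k1 tau tau1 ->
  (2 * k t * k1 t) ^ 2 =
  (k t ^ 2 + b ^ 2) * (k t ^ 2 - (a - 1) ^ 2) * ((a + 1) ^ 2 - k t ^ 2).
Proof.
  intros H; destruct (H t) as [_ [_ [_ [H4 H5]]]].
  assert (H6 : k t ^ 2 * (tau t - b) = (b * (a ^ 2 - 1) - b * k t ^ 2) / 2)
    by (rewrite <- H4; field).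
  replace ((2 * k t * k1 t) ^ 2) with
    (4 * k t ^ 2 * (k1 t ^ 2 + 1 / 4 * (1 + a ^ 2 - k t ^ 2) ^ 2 + k t ^ 2 * (tau t - b) ^ 2)
     - k t ^ 2 * (1 + a ^ 2 - k t ^ 2) ^ 2 - 4 * (k t ^ 2 * (tau t - b)) ^ 2) by field.
  rewrite H5, H6; field.
Qed.

(** The right-hand side is half the derivative of the cubic above, but it is
    obtained from the equations directly: differentiating the square of (k^2)'
    would lose the points where (k^2)' vanishes. *)
Lemma curvature_square_second_derivative a b k k1 tau tau1 t :
  geodesic_data a b k k1 tau tau1 ->
  is_derive (fun s => 2 * k s * k1 s) t
    ((- 3 * (k t ^ 2) ^ 2 + (4 * (1 + a ^ 2) - 2 * b ^ 2) * k t ^ 2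
      - (a ^ 2 - 1) ^ 2 + 2 * (a ^ 2 + 1) * b ^ 2) / 2).
Proof.
  intros H; destruct (H t) as [H1 [H2 [_ [H4 H5]]]].
  assert (H6 : k t ^ 2 * (tau t - b) = (b * (a ^ 2 - 1) - b * k t ^ 2) / 2)
    by (rewrite <- H4; field).
  auto_derive; [split; [now eexists; apply H1 | split; [now eexists; apply H2 | easy]] |].
  derive_subst.
  replace (_ + _) with
    (2 * (k1 t ^ 2 + 1 / 4 * (1 + a ^ 2 - k t ^ 2) ^ 2 + k t ^ 2 * (tau t - b) ^ 2)
     - 1 / 2 * (1 + a ^ 2 - k t ^ 2) ^ 2
     + 2 * b * (k t ^ 2 * (tau t - b)) + k t ^ 2 * (1 + a ^ 2 - k t ^ 2)) by field.
  rewrite H5, H6; field.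
Qed.

(** A tangent line of nonzero slope crosses zero. *)
Lemma concave_positive_constant (z z1 z2 : R -> R) :
  (forall t, 0 < z t) -> (forall t, is_derive z t (z1 t)) ->
  (forall t, is_derive z1 t (z2 t)) -> (forall t, z2 t <= 0) -> forall t, z1 t = 0.
Proof.
  intros Hz D1 D2 H2.
  assert (M : forall s t, s <= t -> z1 t <= z1 s).
  { intros s t Hst; destruct (MVT_gen z1 s t z2) as [c [_ E]].
    - intros; apply D2.
    - intros; eapply is_derive_continuity_pt, D2.
    - specialize (H2 c); nra. }
  assert (T : forall s t, z t <= z s + z1 s * (t - s)).
  { intros s t; destruct (MVT_gen z s t z1) as [c [Hc E]].
    - intros; apply D1.
    - intros; eapply is_derive_continuity_pt, D1.
    - destruct (Rle_lt_dec s t) as [L | L].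
      + rewrite Rmin_left in Hc by lra.
        pose proof (M s c (proj1 Hc)); nra.
      + rewrite Rmax_left in Hc by lra.
        pose proof (M c s (proj2 Hc)); nra. }
  intros t; destruct (Req_dec (z1 t) 0) as [E | E]; [exact E | exfalso].
  specialize (T t (t - z t / z1 t)); pose proof (Hz (t - z t / z1 t)).
  replace (z t + _) with 0 in T by (field; exact E); lra.
Qed.

(** The cubic is a square, hence nonnegative.  Its root k^2 = -b^2 is attained only
    if b = k = 0 at some point; then k' = 0 there and k vanishes identically. *)
Lemma curvature_square_range a b k k1 tau tau1 t :
  0 < a -> geodesic_data a b k k1 tau tau1 -> (exists s, k s <> 0) ->
  (a - 1) ^ 2 <= k t ^ 2 <= (a + 1) ^ 2.
Proof.
  intros Ha H [s Hs].
  pose proof (curvature_square_first_integral a b k k1 tau tau1 t H) as I.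
  pose proof (pow2_ge_0 (2 * k t * k1 t)) as P; rewrite I in P; clear I.
  pose proof (pow2_ge_0 (k t)) as Hu; pose proof (pow2_ge_0 b) as Hb.
  assert (Hlt : (a - 1) ^ 2 < (a + 1) ^ 2) by nra.
  split; apply Rnot_lt_le; intros L.
  - destruct (Req_dec (k t ^ 2 + b ^ 2) 0) as [Z | Z].
    + apply Hs, (curvature_zero a b k k1 tau tau1 t H); [nra |].
      assert (K : k t = 0) by nra; assert (B : b = 0) by nra.
      destruct (H t) as [_ [_ [_ [_ H5]]]]; rewrite K, B in H5; nra.
    + assert (0 < (k t ^ 2 + b ^ 2) * ((a - 1) ^ 2 - k t ^ 2) * ((a + 1) ^ 2 - k t ^ 2))
        by (apply Rmult_lt_0_compat; [apply Rmult_lt_0_compat |]; lra).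
      lra.
  - assert (0 < (a + 1) ^ 2) by nra.
    assert (0 < (k t ^ 2 + b ^ 2) * (k t ^ 2 - (a - 1) ^ 2) * (k t ^ 2 - (a + 1) ^ 2))
      by (apply Rmult_lt_0_compat; [apply Rmult_lt_0_compat |]; lra).
    lra.
Qed.

(** If k^2 stays below (a + 1)^2, then z = sqrt((a + 1)^2 - k^2) satisfies
    z'' = - z ((k^2 + b^2) + (k^2 - (a - 1)^2)) / 4 <= 0 on the whole line.  So z is
    constant, both brackets vanish, and k = 0. *)
Lemma curvature_maximum a b k k1 tau tau1 :
  0 < a -> geodesic_data a b k k1 tau tau1 -> (exists s, k s <> 0) ->
  exists t, k t ^ 2 = (a + 1) ^ 2 /\ k1 t = 0.
Proof.
  intros Ha H Hnz.
  destruct (classic (exists t, k t ^ 2 = (a + 1) ^ 2)) as [[t Ht] | Hno].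
  { exists t; split; [exact Ht |].
    pose proof (curvature_square_first_integral a b k k1 tau tau1 t H) as I.
    rewrite Ht, Rminus_diag, Rmult_0_r in I.
    assert (k t <> 0) by (intros K; rewrite K in Ht; nra).
    assert (Z : 2 * k t * k1 t = 0) by nra.
    apply Rmult_integral in Z; lra. }
  exfalso.
  assert (Rg : forall t, (a - 1) ^ 2 <= k t ^ 2 < (a + 1) ^ 2).
  { intros t; pose proof (curvature_square_range a b k k1 tau tau1 t Ha H Hnz).
    destruct (Req_dec (k t ^ 2) ((a + 1) ^ 2)) as [E | E]; [| lra].
    exfalso; apply Hno; now exists t. }
  set (z := fun t => sqrt ((a + 1) ^ 2 - k t ^ 2)).
  assert (Z : forall t, 0 < z t) by (intros t; apply sqrt_lt_R0; specialize (Rg t); lra).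
  assert (Z2 : forall t, z t ^ 2 = (a + 1) ^ 2 - k t ^ 2)
    by (intros t; apply pow2_sqrt; specialize (Rg t); lra).
  assert (D1 : forall t, is_derive z t (- (k t * k1 t) / z t)).
  { intros t; destruct (H t) as [H1 _]; unfold z at 1.
    specialize (Rg t).
    auto_derive; [split; [now exists (k1 t) | split; [lra | easy]] |].
    derive_subst.
    change (sqrt _) with (sqrt ((a + 1) * ((a + 1) * 1) + - (k t * (k t * 1)))).
    replace ((a + 1) * ((a + 1) * 1) + - (k t * (k t * 1))) with ((a + 1) ^ 2 - k t ^ 2) by ring.
    fold (z t); specialize (Z t); field; lra. }
  assert (D2 : forall t, is_derive (fun t => - (k t * k1 t) / z t) t
    (- z t * ((k t ^ 2 + b ^ 2) + (k t ^ 2 - (a - 1) ^ 2)) / 4)).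
  { intros t.
    pose proof (curvature_square_second_derivative a b k k1 tau tau1 t H) as Du.
    pose proof (curvature_square_first_integral a b k k1 tau tau1 t H) as I.
    specialize (Z t).
    apply (is_derive_ext (fun s => - / 2 * (2 * k s * k1 s) * / z s)).
    { intros s; change (- / 2 * (2 * k s * k1 s) * / z s = - (k s * k1 s) / z s).
      field; apply Rgt_not_eq, sqrt_lt_R0; specialize (Rg s); lra. }
    specialize (D1 t).
    assert (Dq : forall (v w : R -> R) (dv dw : R), is_derive v t dv -> is_derive w t dw ->
      w t <> 0 -> is_derive (fun s => - / 2 * v s * / w s) t
        (- / 2 * (dv / w t - v t * dw / w t ^ 2))).
    { intros v w dv dw Dv Dw Hw.
      auto_derive; [split; [now exists dv | split; [now exists dw | easy]] |].
      derive_subst; field; exact Hw. }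
    eapply is_derive_eq.
    - apply (Dq _ _ _ _ Du D1); lra.
    - cbv beta.
      apply Rmult_eq_reg_r with (z t ^ 3); [| apply pow_nonzero; lra].
      match goal with |- ?l * _ = ?r * _ =>
        transitivity (- / 2 * ((- 3 * (k t ^ 2) ^ 2 + (4 * (1 + a ^ 2) - 2 * b ^ 2) * k t ^ 2
          - (a ^ 2 - 1) ^ 2 + 2 * (a ^ 2 + 1) * b ^ 2) / 2) * z t ^ 2
          - (2 * k t * k1 t) ^ 2 / 4) end.
      + field; lra.
      + rewrite I, Z2.
        replace (z t ^ 3) with (z t * z t ^ 2) by ring.
        transitivity (- (z t ^ 2) ^ 2 * (k t ^ 2 + b ^ 2 + (k t ^ 2 - (a - 1) ^ 2)) / 4);
          [rewrite Z2; field | field]. }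
  assert (E : forall t, - (k t * k1 t) / z t = 0).
  { apply (concave_positive_constant z _ _ Z D1 D2).
    intros t; specialize (Rg t); specialize (Z t); pose proof (pow2_ge_0 (k t));
      pose proof (pow2_ge_0 b); nra. }
  destruct Hnz as [s Hs].
  assert (E2 : - z s * ((k s ^ 2 + b ^ 2) + (k s ^ 2 - (a - 1) ^ 2)) / 4 = 0).
  { rewrite <- (is_derive_unique _ _ _ (D2 s)), <- (Derive_const 0 s).
    apply Derive_ext; exact E. }
  specialize (Rg s); specialize (Z s); pose proof (pow2_ge_0 b).
  assert (0 < k s ^ 2) by nra.
  nra.
Qed.

(** The difference e = k^2 - l^2 solves a linear equation e'' = h e, because the
    second derivative of k^2 is a polynomial in k^2; hence e = 0.  Then k and l
    solve the same linear equation k'' = g k, where the torsions are equal as soon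
    as k does not vanish. *)
Lemma curvature_determined a b k k1 tau tau1 l l1 sigma sigma1 s :
  geodesic_data a b k k1 tau tau1 -> geodesic_data a b l l1 sigma sigma1 ->
  k s <> 0 -> k s ^ 2 = l s ^ 2 -> k1 s = 0 -> l1 s = 0 ->
  exists e, (e = 1 \/ e = -1) /\ forall t, l t = e * k t /\ sigma t = tau t.
Proof.
  intros Hk Hl Ks Kl K1 L1.
  assert (Sq : forall t, k t ^ 2 - l t ^ 2 = 0).
  { apply (second_order_zero _ (fun t => 2 * k t * k1 t - 2 * l t * l1 t)
      (fun t => (- 3 * (k t ^ 2 + l t ^ 2) + (4 * (1 + a ^ 2) - 2 * b ^ 2)) / 2) s).
    - intros t; destruct (Hk t) as [D1 _], (Hl t) as [D2 _].
      eapply is_derive_continuity_pt; auto_derive;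
        [split; [now eexists; apply D1 | split; [now eexists; apply D2 | easy]] | reflexivity].
    - intros t; destruct (Hk t) as [D1 _], (Hl t) as [D2 _].
      auto_derive;
        [split; [now eexists; apply D1 | split; [now eexists; apply D2 | easy]] |].
      derive_subst; ring.
    - intros t.
      pose proof (curvature_square_second_derivative _ _ _ _ _ _ t Hk) as D1.
      pose proof (curvature_square_second_derivative _ _ _ _ _ _ t Hl) as D2.
      eapply is_derive_eq; [apply @is_derive_minus; [apply D1 | apply D2] |].
      unfold minus, plus, opp; simpl; field.
    - lra.
    - rewrite K1, L1; ring. }
  assert (He : exists e, (e = 1 \/ e = -1) /\ l s = e * k s).
  { assert (Z : (l s - k s) * (l s + k s) = 0) by nra.
    apply Rmult_integral in Z; destruct Z as [Z | Z];
      [exists 1 | exists (-1)]; split; auto; lra. }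
  destruct He as [e [He El]]; exists e; split; [exact He |].
  assert (Tau : forall t, k t <> 0 -> sigma t = tau t).
  { intros t K; destruct (Hk t) as [_ [_ [_ [E1 _]]]], (Hl t) as [_ [_ [_ [E2 _]]]].
    specialize (Sq t); assert (k t ^ 2 <> 0) by (apply pow_nonzero, K).
    assert (Z : k t ^ 2 * (2 * tau t - 2 * sigma t) = 0).
    { replace (l t ^ 2) with (k t ^ 2) in E2 by lra; lra. }
    apply Rmult_integral in Z; lra. }
  assert (L : forall t, l t = e * k t).
  { intros t; apply Rminus_diag_uniq; revert t.
    apply (second_order_zero _ (fun t => l1 t - e * k1 t)
      (fun t => tau t * (tau t - b) + (1 + a ^ 2 - k t ^ 2) / 2) s).
    - intros t; destruct (Hk t) as [H1 [_ [H3 _]]].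
      eapply is_derive_continuity_pt.
      auto_derive; [repeat split; eexists; eassumption |].
      reflexivity.
    - intros t; destruct (Hk t) as [D1 _], (Hl t) as [D2 _].
      auto_derive; [split; [now eexists; apply D2 | split; [now eexists; apply D1 | easy]] |].
      derive_subst; ring.
    - intros t; destruct (Hk t) as [_ [D1 _]], (Hl t) as [_ [D2 _]].
      auto_derive; [split; [now eexists; apply D2 | split; [now eexists; apply D1 | easy]] |].
      derive_subst.
      specialize (Sq t); replace (l t ^ 2) with (k t ^ 2) by lra.
      destruct (Req_dec (k t) 0) as [K | K].
      + assert (l t = 0) as -> by (rewrite K in Sq; nra); rewrite K; ring.
      + rewrite (Tau t K); ring.
    - rewrite El; ring.
    - rewrite K1, L1; ring. }
  intros t; split; [apply L |].
  destruct (Req_dec (k t) 0) as [K | K]; [| now apply Tau].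
  assert (Lt : l t = 0) by (rewrite L, K; ring).
  assert (Ls : l s <> 0) by (rewrite El; destruct He as [-> | ->]; lra).
  assert (A1 := torsion_at_inflection _ _ _ _ _ _ t Hk K
    (fun E => Ks (curvature_zero _ _ _ _ _ _ t Hk K E s))).
  assert (A2 := torsion_at_inflection _ _ _ _ _ _ t Hl Lt
    (fun E => Ls (curvature_zero _ _ _ _ _ _ t Hl Lt E s))).
  lra.
Qed.

(** * First variation of length *)

Lemma is_derive_quadratic_bound (L : R -> R) d K :
  0 < d -> (forall s, Rabs s < d -> Rabs (L s - L 0) <= K * s ^ 2) ->
  is_derive L 0 0.
Proof.
  intros Hd H; apply is_derive_Reals; intros eps He.
  assert (Hp : 0 < Rmin d (eps / (Rabs K + 1))).
  { apply Rmin_glb_lt; [exact Hd |]; apply Rdiv_lt_0_compat; [exact He |].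
    pose proof (Rabs_pos K); lra. }
  exists (mkposreal _ Hp); simpl; intros h Hh Hlt.
  pose proof (Rlt_le_trans _ _ _ Hlt (Rmin_l _ _)) as H1.
  pose proof (Rlt_le_trans _ _ _ Hlt (Rmin_r _ _)) as H2.
  specialize (H h H1); rewrite Rplus_0_l, Rminus_0_r.
  assert (Ha : 0 < Rabs h) by now apply Rabs_pos_lt.
  unfold Rdiv; rewrite Rabs_mult, Rabs_inv.
  apply Rmult_lt_reg_r with (Rabs h); [exact Ha |].
  rewrite Rmult_assoc, Rinv_l, Rmult_1_r by lra.
  eapply Rle_lt_trans; [exact H |].
  rewrite <- (pow2_abs h).
  apply Rle_lt_trans with (Rabs K * Rabs h * Rabs h).
  { pose proof (Rle_abs K); nra. }
  apply Rmult_lt_compat_r; [exact Ha |].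
  assert (HK : 0 < Rabs K + 1) by (pose proof (Rabs_pos K); lra).
  apply (Rmult_lt_compat_r _ _ _ HK) in H2.
  unfold Rdiv in H2; rewrite Rmult_assoc, Rinv_l, Rmult_1_r in H2 by lra.
  lra.
Qed.

(** Uniformity in t comes from the uniform continuity of the partial derivative
    along the segment {0} x [t0, t1]. *)
Lemma lipschitz_in_parameter (f : R -> R -> R) t0 t1 :
  t0 <= t1 -> (forall s t, ex_diff_n f 1 s t) ->
  exists C d, 0 < d /\ forall s t, Rabs s < d -> t0 <= t <= t1 ->
    (f s t - f 0 t) ^ 2 <= C * s ^ 2.
Proof.
  intros Ht Hf.
  set (g := fun s t => Derive (fun z => f z t) s).
  assert (Hg : forall s t, continuity_2d_pt g s t)
    by (intros s t; destruct (Hf s t) as [_ [_ [_ [[H _] _]]]]; exact H).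
  destruct (uniform_continuity_2d_1d' g t0 t1 0 (fun t _ => Hg 0 t)
    (mkposreal 1 Rlt_0_1)) as [d Hd]; simpl in Hd.
  destruct (continuity_ab_maj (fun t => Rabs (g 0 t)) t0 t1 Ht) as [M [HM _]].
  { intros t _; apply (continuity_pt_comp (g 0) Rabs); [| apply Rcontinuity_abs].
    intros eps He; destruct (Hg 0 t (mkposreal eps He)) as [e H].
    exists e; split; [apply cond_pos |]; intros u [_ Hu].
    apply H; [rewrite Rminus_diag, Rabs_R0; apply cond_pos | exact Hu]. }
  exists ((Rabs (g 0 M) + 1) ^ 2), d; split; [apply cond_pos |].
  intros s t Hs Ht'.
  destruct (MVT_gen (fun z => f z t) 0 s (fun z => g z t)) as [c [Hc E]].
  - intros z _; destruct (Hf z t) as [_ [D _]]; now apply Derive_correct.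
  - intros z _; destruct (Hf z t) as [_ [[l Hl] _]].
    now apply is_derive_continuity_pt with l.
  - rewrite E, Rminus_0_r, Rpow_mult_distr.
    apply Rmult_le_compat_r; [apply pow2_ge_0 |].
    rewrite <- (pow2_abs (g c t)).
    apply pow_incr; split; [apply Rabs_pos |].
    assert (Hcd : - d < c < d).
    { apply Rabs_lt_between in Hs.
      destruct (Rle_lt_dec 0 s) as [L | L];
        [rewrite Rmin_left, Rmax_right in Hc | rewrite Rmin_right, Rmax_left in Hc]; lra. }
    assert (Hc' : Rabs (g c t - g 0 t) < 1).
    { apply Hd; try lra; rewrite Rminus_diag, Rabs_R0; apply cond_pos. }
    specialize (HM t Ht').
    replace (g c t) with ((g c t - g 0 t) + g 0 t) by ring.
    eapply Rle_trans; [apply Rabs_triang |]; lra.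
Qed.

Lemma lipschitz_in_parameter_E3 (F : R -> R -> E3) t0 t1 :
  t0 <= t1 ->
  (forall s t, ex_diff_n (fun u v => Defs.c1 (F u v)) 1 s t /\
    ex_diff_n (fun u v => c2 (F u v)) 1 s t /\ ex_diff_n (fun u v => c3 (F u v)) 1 s t) ->
  exists C d, 0 < d /\ forall s t, Rabs s < d -> t0 <= t <= t1 ->
    dot (minus (F s t) (F 0 t)) (minus (F s t) (F 0 t)) <= C * s ^ 2.
Proof.
  intros Ht HF.
  destruct (lipschitz_in_parameter (fun u v => Defs.c1 (F u v)) t0 t1 Ht) as [C1 [d1 [P1 H1]]];
    [intros; apply HF |].
  destruct (lipschitz_in_parameter (fun u v => c2 (F u v)) t0 t1 Ht) as [C2 [d2 [P2 H2]]];
    [intros; apply HF |].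
  destruct (lipschitz_in_parameter (fun u v => c3 (F u v)) t0 t1 Ht) as [C3 [d3 [P3 H3]]];
    [intros; apply HF |].
  exists (C1 + C2 + C3), (Rmin d1 (Rmin d2 d3)); split.
  { repeat apply Rmin_glb_lt; assumption. }
  intros s t Hs Ht'.
  pose proof (Rlt_le_trans _ _ _ Hs (Rmin_l _ _)) as S1.
  pose proof (Rlt_le_trans _ _ _ Hs (Rmin_r _ _)) as S23.
  pose proof (Rlt_le_trans _ _ _ S23 (Rmin_l _ _)) as S2.
  pose proof (Rlt_le_trans _ _ _ S23 (Rmin_r _ _)) as S3.
  specialize (H1 s t S1 Ht'); specialize (H2 s t S2 Ht'); specialize (H3 s t S3 Ht').
  replace (dot _ _) with ((Defs.c1 (F s t) - Defs.c1 (F 0 t)) ^ 2 +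
    (c2 (F s t) - c2 (F 0 t)) ^ 2 + (c3 (F s t) - c3 (F 0 t)) ^ 2) by E3_ring.
  lra.
Qed.

Lemma dot_sqr_le u v : dot u v ^ 2 <= dot u u * dot v v.
Proof.
  assert (H : dot u u * dot v v - dot u v ^ 2 = dot (cross u v) (cross u v)) by E3_ring.
  pose proof (dot_self_pos (cross u v)); lra.
Qed.

(** The lower bound is the Cauchy inequality, the upper one the inequality
    between the arithmetic and geometric means of [1] and [|w|^2]. *)
Lemma norm_near_unit (T w : E3) :
  dot T T = 1 ->
  0 <= norm w - dot T w <= dot (minus w T) (minus w T) / 2.
Proof.
  intros HT.
  rewrite dot_minus_l, !dot_minus_r, HT, (dot_comm w T), norm_E3.
  pose proof (dot_sqr_le T w) as CS; rewrite HT, Rmult_1_l in CS.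
  pose proof (dot_self_pos w) as P.
  pose proof (sqrt_pos (dot w w)) as Q; pose proof (sqrt_sqrt _ P) as E.
  split.
  - destruct (Rle_lt_dec (dot T w) (sqrt (dot w w))) as [L | L]; [lra | exfalso; nra].
  - pose proof (pow2_ge_0 (sqrt (dot w w) - 1)); lra.
Qed.

Lemma is_derive_velocity (F : R -> R -> E3) s t :
  smooth2 F -> is_derive (F s) t (velocity (F s) t).
Proof.
  intros HF; destruct (HF 1%nat s t) as [[_ [_ [D1 _]]] [[_ [_ [D2 _]]] [_ [_ [D3 _]]]]].
  apply is_derive_E3; split; [| split]; apply Derive_correct; assumption.
Qed.

Lemma ex_derive_velocity (F : R -> R -> E3) s t :
  smooth2 F -> exists l, is_derive (velocity (F s)) t l.
Proof.
  intros HF.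
  destruct (HF 2%nat s t) as [[_ [_ [_ [_ [_ [_ [[l1 D1] _]]]]]]]
    [[_ [_ [_ [_ [_ [_ [[l2 D2] _]]]]]]] [_ [_ [_ [_ [_ [_ [[l3 D3] _]]]]]]]]].
  exists (l1, l2, l3); apply is_derive_E3; split; [| split]; assumption.
Qed.

Lemma continuity_dot (f g : R -> E3) t :
  (exists l, is_derive f t l) -> (exists l, is_derive g t l) ->
  continuity_pt (fun s => dot (f s) (g s)) t.
Proof.
  intros [l Hl] [l' Hl']; eapply is_derive_continuity_pt, is_derive_dot; eassumption.
Qed.

(** The coefficient of y' along the frame V is found by differentiating
    |V|^2 = 1. *)
Lemma bicycle_frame_derivative (X Y : R -> E3) t t0 t1 :
  t0 < t < t1 -> (forall u, t0 <= u <= t1 -> bicycle_at X Y u) ->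
  is_derive X t (velocity X t) -> is_derive Y t (velocity Y t) ->
  velocity Y t =
    scal (dot (velocity X t) (minus (X t) (Y t))) (minus (X t) (Y t)).
Proof.
  intros Ht HB DX DY.
  set (V := fun u => minus (X u) (Y u)).
  assert (VV : forall u, t0 <= u <= t1 -> dot (V u) (V u) = 1)
    by (intros u Hu; apply norm_eq_1, HB, Hu).
  destruct (HB t ltac:(lra)) as [_ [c Hc]].
  assert (E : velocity Y t = scal c (V t)).
  { apply is_derive_E3 in Hc as [E1 [E2 E3]].
    apply E3_ext; [now apply is_derive_unique in E1 |
      now apply is_derive_unique in E2 | now apply is_derive_unique in E3]. }
  assert (DV : is_derive V t (minus (velocity X t) (velocity Y t)))
    by (apply @is_derive_minus; assumption).
  pose proof (is_derive_dot V V t _ _ DV DV) as D.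
  apply is_derive_unique in D.
  rewrite (Derive_ext_loc _ (fun _ => 1)) in D.
  2: { assert (He : 0 < Rmin (t - t0) (t1 - t)) by (apply Rmin_glb_lt; lra).
       exists (mkposreal _ He); intros u Hu; apply VV.
       change (Rabs (u - t) < Rmin (t - t0) (t1 - t)) in Hu.
       pose proof (Rmin_l (t - t0) (t1 - t)); pose proof (Rmin_r (t - t0) (t1 - t)).
       apply Rabs_lt_between in Hu; lra. }
  rewrite Derive_const, (dot_comm (V t)), E, dot_minus_l, dot_scal_l, VV in D by lra.
  rewrite E; fold (V t); f_equal; lra.
Qed.

(** Let Phi = p.X + r.V.  Using the equation of [r] and V_t = X_t - (X_t.V) V, the
    length density differs from the t-derivative of Phi by
      (|X_t| - T.X_t) + (r.V) (X_t.V - T.v) + (r.T) (v.V),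
    where the first two terms are O(s^2) since r.v = 0, and v.V = 1 + O(s^2) since v
    and V are unit vectors.  As Phi takes prescribed values at the ends, the length
    is constant up to O(s^2). *)
Lemma length_critical_of_costate (x y T r : R -> E3) (p : E3) t0 t1 X Y :
  bicycle_path x y ->
  (forall t, is_derive x t (T t)) ->
  (forall t, dot (T t) (T t) = 1) ->
  (forall t, T t = plus p (r t)) ->
  (forall t, dot (r t) (minus (x t) (y t)) = 0) ->
  (forall t, is_derive r t
     (minus (scal (dot (T t) (minus (x t) (y t))) (r t))
            (scal (dot (r t) (T t)) (minus (x t) (y t))))) ->
  t0 < t1 -> variation x y t0 t1 X Y ->
  is_derive (fun s : R => length (X s) t0 t1) 0 0.
Proof.
  intros [Hsx [Hsy Hbic]] Hx HTT HT Hrv Hr Ht [HX [HY [H0 [d0 Hd0]]]].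
  set (v := fun t => minus (x t) (y t)) in *.
  set (V := fun s t => minus (X s t) (Y s t)).
  assert (Hvv : forall t, dot (v t) (v t) = 1)
    by (intros t; apply norm_eq_1, Hbic).
  assert (Dv : forall t, exists l, is_derive v t l).
  { intros t; destruct (Hbic t) as [_ [c Hc]].
    eexists; apply @is_derive_minus; [apply Hx | apply Hc]. }
  assert (Dr : forall t, exists l, is_derive r t l) by (intros t; eexists; apply Hr).
  assert (DT : forall t, exists l, is_derive T t l).
  { intros t; destruct (Dr t) as [l Hl]; eexists.
    apply (is_derive_ext (fun t => plus p (r t))); [intros; now rewrite HT |].
    apply @is_derive_plus; [apply @is_derive_const | exact Hl]. }
  assert (DX : forall s t, is_derive (X s) t (velocity (X s) t))
    by (intros; now apply is_derive_velocity).
  assert (DY : forall s t, is_derive (Y s) t (velocity (Y s) t))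
    by (intros; now apply is_derive_velocity).
  assert (DV : forall s t, is_derive (V s) t (minus (velocity (X s) t) (velocity (Y s) t)))
    by (intros; apply @is_derive_minus; auto).
  assert (V0 : forall t, t0 <= t <= t1 -> V 0 t = v t)
    by (intros t Ht'; unfold V, v; now destruct (H0 t Ht') as [-> ->]).
  assert (X0 : forall t, t0 < t < t1 -> velocity (X 0) t = T t).
  { intros t Ht'.
    specialize (Hx t); apply is_derive_E3 in Hx as [E1 [E2 E3]].
    assert (L : locally t (fun u => X 0 u = x u)).
    { assert (He : 0 < Rmin (t - t0) (t1 - t)) by (apply Rmin_glb_lt; lra).
      exists (mkposreal _ He); intros u Hu; apply H0.
      change (Rabs (u - t) < Rmin (t - t0) (t1 - t)) in Hu.
      pose proof (Rmin_l (t - t0) (t1 - t)); pose proof (Rmin_r (t - t0) (t1 - t)).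
      apply Rabs_lt_between in Hu; lra. }
    apply E3_ext; [rewrite <- (is_derive_unique _ _ _ E1) |
      rewrite <- (is_derive_unique _ _ _ E2) | rewrite <- (is_derive_unique _ _ _ E3)];
      apply Derive_ext_loc; revert L; apply filter_imp; now intros u ->. }
  destruct (lipschitz_in_parameter_E3 V t0 t1) as [CV [dV [PV LV]]]; [lra | |].
  { intros s t.
    assert (M : forall f g : R -> R -> R, (forall n s t, ex_diff_n f n s t) ->
      (forall n s t, ex_diff_n g n s t) -> ex_diff_n (fun u v => f u v - g u v) 1 s t).
    { intros f g Hf Hg.
      destruct (Hf 1%nat s t) as [F0 [F1 [F2 [[F3 _] [F4 _]]]]].
      destruct (Hg 1%nat s t) as [G0 [G1 [G2 [[G3 _] [G4 _]]]]].
      simpl; split; [now apply continuity_2d_pt_minus |].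
      split; [now apply @ex_derive_minus |]; split; [now apply @ex_derive_minus |].
      split; split; try exact I.
      - apply (continuity_2d_pt_ext (fun u v =>
          Derive (fun z => f z v) u - Derive (fun z => g z v) u)).
        + intros x0 y0; symmetry; apply Derive_minus;
            [now destruct (Hf 1%nat x0 y0) as [_ [? [? _]]]
            | now destruct (Hg 1%nat x0 y0) as [_ [? [? _]]]].
        + now apply continuity_2d_pt_minus.
      - apply (continuity_2d_pt_ext (fun u v =>
          Derive (fun z => f u z) v - Derive (fun z => g u z) v)).
        + intros x0 y0; symmetry; apply Derive_minus;
            [now destruct (Hf 1%nat x0 y0) as [_ [? [? _]]]
            | now destruct (Hg 1%nat x0 y0) as [_ [? [? _]]]].
        + now apply continuity_2d_pt_minus. }
    split; [| split].
    - apply (M (fun u v => Defs.c1 (X u v)) (fun u v => Defs.c1 (Y u v)));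
        intros; [apply HX | apply HY].
    - apply (M (fun u v => c2 (X u v)) (fun u v => c2 (Y u v)));
        intros; [apply HX | apply HY].
    - apply (M (fun u v => c3 (X u v)) (fun u v => c3 (Y u v)));
        intros; [apply HX | apply HY]. }
  destruct (lipschitz_in_parameter_E3 (fun s t => velocity (X s) t) t0 t1)
    as [CX [dX [PX LX]]]; [lra | |].
  { intros s t; destruct (HX 2%nat s t) as [[_ [_ [_ [_ K1]]]]
      [[_ [_ [_ [_ K2]]]] [_ [_ [_ [_ K3]]]]]].
    split; [exact K1 | split; [exact K2 | exact K3]]. }
  destruct (continuity_ab_maj (fun t => dot (r t) (r t)) t0 t1) as [tr [Mr _]];
    [lra | intros; apply continuity_dot; apply Dr |].
  set (R2 := dot (r tr) (r tr)) in Mr.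
  assert (R2pos : 0 <= R2) by apply dot_self_pos.
  set (Phi := fun s t => dot p (X s t) + dot (r t) (V s t)).
  set (dPhi := fun s t => dot p (velocity (X s) t)
    + ((dot (T t) (v t) * dot (r t) (V s t) - dot (r t) (T t) * dot (v t) (V s t))
       + (dot (r t) (velocity (X s) t) - dot (r t) (velocity (Y s) t)))).
  assert (DPhi : forall s t, is_derive (Phi s) t (dPhi s t)).
  { intros s t; apply @is_derive_plus.
    - eapply is_derive_eq; [apply is_derive_dot; [apply @is_derive_const | apply DX] |].
      E3_ring.
    - eapply is_derive_eq; [apply is_derive_dot; [apply Hr | apply DV] |].
      rewrite dot_minus_l, !dot_scal_l, (dot_minus_r (r t) (velocity (X s) t)); reflexivity. }
  assert (CPhi : forall s t, continuity_pt (dPhi s) t).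
  { intros s t; unfold dPhi.
    assert (Ep : exists l, is_derive (fun _ : R => p) t l)
      by (eexists; apply @is_derive_const).
    assert (EV : exists l, is_derive (V s) t l) by (eexists; apply DV).
    assert (EX := ex_derive_velocity X s t HX); assert (EY := ex_derive_velocity Y s t HY).
    specialize (DT t); specialize (Dv t); specialize (Dr t).
    apply (continuity_pt_plus (fun t => dot p (velocity (X s) t)) (fun t =>
      (dot (T t) (v t) * dot (r t) (V s t) - dot (r t) (T t) * dot (v t) (V s t))
       + (dot (r t) (velocity (X s) t) - dot (r t) (velocity (Y s) t))));
      [now apply (continuity_dot (fun _ => p)) |].
    apply (continuity_pt_plus (fun t => dot (T t) (v t) * dot (r t) (V s t)
        - dot (r t) (T t) * dot (v t) (V s t))
      (fun t => dot (r t) (velocity (X s) t) - dot (r t) (velocity (Y s) t))).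
    - apply (continuity_pt_minus (fun t => dot (T t) (v t) * dot (r t) (V s t))
        (fun t => dot (r t) (T t) * dot (v t) (V s t))).
      + apply (continuity_pt_mult (fun t => dot (T t) (v t)) (fun t => dot (r t) (V s t)));
          now apply continuity_dot.
      + apply (continuity_pt_mult (fun t => dot (r t) (T t)) (fun t => dot (v t) (V s t)));
          now apply continuity_dot.
    - apply (continuity_pt_minus (fun t => dot (r t) (velocity (X s) t))
        (fun t => dot (r t) (velocity (Y s) t))); now apply continuity_dot. }
  assert (CN : forall s t, continuity_pt (fun u => norm (velocity (X s) u)) t).
  { intros s t; apply continuity_pt_ext with
      (fun u => sqrt (dot (velocity (X s) u) (velocity (X s) u))).
    { intros u; symmetry; apply norm_E3. }
    apply (continuity_pt_comp (fun u => dot (velocity (X s) u) (velocity (X s) u)) sqrt).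
    - apply continuity_dot; now apply ex_derive_velocity.
    - apply continuity_pt_sqrt, dot_self_pos. }
  assert (CrT : forall t, continuity_pt (fun u => dot (r u) (T u)) t)
    by (intros t; now apply continuity_dot).
  set (K := (CX + R2 * CV + 2 * (CX + CV) + (R2 + 1) * CV) / 2).
  (* At s = 0 the density minus the derivative of Phi is r.T; K collects the
     quadratic terms of the three summands. *)
  assert (Key : forall s, Rabs s < Rmin d0 (Rmin dV dX) -> forall t, t0 < t < t1 ->
    Rabs (norm (velocity (X s) t) - dPhi s t - dot (r t) (T t)) <= K * s ^ 2).
  { intros s Hs t Ht'.
    pose proof (Rlt_le_trans _ _ _ Hs (Rmin_l _ _)) as S0.
    pose proof (Rlt_le_trans _ _ _ Hs (Rmin_r _ _)) as S12.
    pose proof (Rlt_le_trans _ _ _ S12 (Rmin_l _ _)) as S1.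
    pose proof (Rlt_le_trans _ _ _ S12 (Rmin_r _ _)) as S2.
    specialize (LV s t S1 ltac:(lra)); specialize (LX s t S2 ltac:(lra)); cbv beta in LX.
    rewrite X0 in LX by exact Ht'; rewrite V0 in LV by lra.
    assert (HB : forall u, t0 <= u <= t1 -> bicycle_at (X s) (Y s) u).
    { apply Hd0; change (Rabs (s - 0) < d0); now rewrite Rminus_0_r. }
    pose proof (bicycle_frame_derivative (X s) (Y s) t t0 t1 Ht' HB (DX s t) (DY s t)) as EY.
    fold (V s t) in EY.
    assert (VV : dot (V s t) (V s t) = 1)
      by (apply norm_eq_1, (HB t); lra).
    pose proof (norm_near_unit (T t) (velocity (X s) t) (HTT t)) as Hn.
    specialize (HTT t); specialize (Hvv t); specialize (Hrv t); fold (v t) in Hrv.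
    specialize (Mr t ltac:(lra)); fold R2 in Mr.
    unfold dPhi; rewrite EY, dot_scal_r; clear EY.
    assert (ET : dot p (velocity (X s) t) =
      dot (T t) (velocity (X s) t) - dot (r t) (velocity (X s) t))
      by (rewrite (HT t), dot_plus_l; ring).
    rewrite ET; clear ET.
    set (w := velocity (X s) t) in *; set (u := V s t) in *.
    set (d := minus u (v t)) in *; set (e := minus w (T t)) in *.
    assert (E1 : dot (r t) u = dot (r t) d) by (unfold d; rewrite dot_minus_r, Hrv; ring).
    assert (E2 : dot w u - dot (T t) (v t) = dot e u + dot (T t) d)
      by (unfold d, e; rewrite dot_minus_l, dot_minus_r; ring).
    assert (E3 : dot (v t) u - 1 = - dot d d / 2).
    { unfold d; rewrite dot_minus_l, !dot_minus_r, VV, Hvv, (dot_comm u (v t)); field. }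
    replace (_ - _ - _) with ((norm w - dot (T t) w)
      + dot (r t) u * (dot w u - dot (T t) (v t))
      + dot (r t) (T t) * (dot (v t) u - 1)) by ring.
    rewrite E1, E2, E3.
    pose proof (dot_sqr_le (r t) d) as Q1; pose proof (dot_sqr_le e u) as Q2;
    pose proof (dot_sqr_le (T t) d) as Q3; pose proof (dot_sqr_le (r t) (T t)) as Q4.
    rewrite VV in Q2; rewrite HTT in Q3, Q4.
    pose proof (dot_self_pos d) as Pd; pose proof (dot_self_pos e) as Pe;
    pose proof (dot_self_pos (r t)) as Pr.
    set (A := dot (r t) d) in *; set (B := dot e u) in *; set (C := dot (T t) d) in *;
    set (G := dot (r t) (T t)) in *; set (dd := dot d d) in *; set (ee := dot e e) in *.
    assert (A2 : A ^ 2 <= R2 * (CV * s ^ 2)).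
    { eapply Rle_trans; [exact Q1 |].
      apply Rmult_le_compat; assumption. }
    assert (BC : (B + C) ^ 2 <= 2 * ((CX + CV) * s ^ 2)).
    { assert ((B + C) ^ 2 <= 2 * (B ^ 2 + C ^ 2)) by (pose proof (pow2_ge_0 (B - C)); nra).
      lra. }
    assert (ABC : Rabs (A * (B + C)) <= (A ^ 2 + (B + C) ^ 2) / 2).
    { pose proof (pow2_ge_0 (A - (B + C))); pose proof (pow2_ge_0 (A + (B + C))).
      apply Rabs_le; nra. }
    assert (HG : Rabs G <= (R2 + 1) / 2).
    { pose proof (pow2_ge_0 (G - 1)); pose proof (pow2_ge_0 (G + 1)).
      apply Rabs_le; nra. }
    assert (HGd : Rabs (G * (- dd / 2)) <= (R2 + 1) / 2 * (CV * s ^ 2)).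
    { rewrite Rabs_mult; apply Rmult_le_compat; try apply Rabs_pos; [exact HG |].
      rewrite Rabs_left1; lra. }
    eapply Rle_trans; [apply Rabs_triang |].
    eapply Rle_trans; [apply Rplus_le_compat_r, Rabs_triang |].
    rewrite (Rabs_pos_eq (norm w - _)) by apply Hn.
    assert (EK : K * s ^ 2 = CX * s ^ 2 / 2 + (R2 * (CV * s ^ 2) + 2 * ((CX + CV) * s ^ 2)) / 2
      + (R2 + 1) / 2 * (CV * s ^ 2)) by (unfold K; field).
    lra. }
  assert (Exc : forall f : R -> R, (forall t, continuity_pt f t) -> ex_RInt f t0 t1).
  { intros f Hf; apply (ex_RInt_continuous (V := R_CompleteNormedModule)).
    intros z _; now apply continuity_pt_filterlim. }
  set (c := Phi 0 t1 - Phi 0 t0 + RInt (fun t => dot (r t) (T t)) t0 t1).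
  assert (Len : forall s, Rabs s < Rmin d0 (Rmin dV dX) ->
    Rabs (length (X s) t0 t1 - c) <= K * (t1 - t0) * s ^ 2).
  { intros s Hs.
    assert (IP : is_RInt (dPhi s) t0 t1 (Phi 0 t1 - Phi 0 t0)).
    { replace (Phi 0 t1 - Phi 0 t0) with (minus (Phi s t1) (Phi s t0)).
      - apply (is_RInt_derive (V := R_CompleteNormedModule)); intros t _; [apply DPhi |].
        now apply continuity_pt_filterlim.
      - unfold Phi, V.
        destruct (Hd0 s) as [_ [-> [-> [-> ->]]]].
        { change (Rabs (s - 0) < d0); rewrite Rminus_0_r.
          apply (Rlt_le_trans _ _ _ Hs), Rmin_l. }
        destruct (H0 t0 ltac:(lra)) as [-> ->]; destruct (H0 t1 ltac:(lra)) as [-> ->].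
        reflexivity. }
    set (D := fun t => norm (velocity (X s) t) - dPhi s t - dot (r t) (T t)).
    assert (CD : forall t, continuity_pt D t).
    { intros t; apply (continuity_pt_minus (fun t => norm (velocity (X s) t) - dPhi s t)
        (fun t => dot (r t) (T t))); [| apply CrT].
      apply (continuity_pt_minus (fun t => norm (velocity (X s) t)) (dPhi s)); auto. }
    assert (ID : is_RInt D t0 t1 (length (X s) t0 t1 - c)).
    { unfold D, c, length.
      replace (_ - _) with (minus (minus (RInt (fun t => norm (velocity (X s) t)) t0 t1)
        (Phi 0 t1 - Phi 0 t0)) (RInt (fun t => dot (r t) (T t)) t0 t1))
        by (unfold minus, plus, opp; simpl; ring).
      apply (is_RInt_minus (V := R_NormedModule)
        (fun t => norm (velocity (X s) t) - dPhi s t));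
        [apply (is_RInt_minus (V := R_NormedModule)); [| exact IP] |];
        apply (RInt_correct (V := R_CompleteNormedModule)); now apply Exc. }
    rewrite <- (is_RInt_unique _ _ _ _ ID).
    replace (K * (t1 - t0) * s ^ 2) with (RInt (fun _ => K * s ^ 2) t0 t1)
      by (rewrite RInt_const; unfold scal; simpl; unfold mult; simpl; ring).
    eapply Rle_trans; [apply abs_RInt_le; [lra | now eexists; apply ID] |].
    apply RInt_le; [lra | | apply Exc; intros; apply continuity_pt_const; now intros ? ? |].
    - apply Exc; intros t; apply (continuity_pt_comp D Rabs); [apply CD | apply Rcontinuity_abs].
    - intros t Ht'; exact (Key s Hs t Ht'). }
  assert (Hpos : 0 < Rmin d0 (Rmin dV dX))
    by (repeat apply Rmin_glb_lt; try assumption; apply cond_pos).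
  apply (is_derive_quadratic_bound _ (Rmin d0 (Rmin dV dX)) (K * (t1 - t0)) Hpos).
  intros s Hs.
  assert (L0 := Len 0); rewrite Rabs_R0 in L0; specialize (L0 Hpos).
  rewrite pow_ne_zero, Rmult_0_r in L0 by lia.
  assert (E : length (X 0) t0 t1 = c).
  { apply Rminus_diag_uniq; destruct (Req_dec (length (X 0) t0 t1 - c) 0) as [E | E];
      [exact E | apply Rabs_pos_lt in E; lra]. }
  rewrite E; now apply Len.
Qed.

(** * The front track of a solution is geodesic *)

(** [frame_T], [frame_N] and [frame_B] are the components in the Frenet frame of
    v = (r x M)/|M|^2, where r has components
    (1 - a^2 + k^2)/2, k', k (tau - b), and M has components b, 0, k. *)
Definition frame_T (b : R) (k k1 : R -> R) (t : R) : R :=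
  k t * k1 t / (k t ^ 2 + b ^ 2).
Definition frame_N (a b : R) (k tau : R -> R) (t : R) : R :=
  k t * (b * (tau t - b) - (1 - a ^ 2 + k t ^ 2) / 2) / (k t ^ 2 + b ^ 2).
Definition frame_B (b : R) (k k1 : R -> R) (t : R) : R :=
  - b * k1 t / (k t ^ 2 + b ^ 2).

(** If k and b vanish, the first integral forces k' = 0. *)
Lemma curvature_momentum_nonzero a b k k1 tau tau1 t :
  geodesic_data a b k k1 tau tau1 -> (exists s, k s <> 0) -> k t ^ 2 + b ^ 2 <> 0.
Proof.
  intros H [s Hs] Q; apply Hs, (curvature_zero a b k k1 tau tau1 t H); [nra |].
  destruct (H t) as [_ [_ [_ [_ H5]]]].
  assert (K : k t = 0) by nra; assert (B : b = 0) by nra.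
  rewrite K, B in H5.
  assert (Z : k1 t ^ 2 + (1 - a ^ 2) ^ 2 / 4 = 0) by lra.
  pose proof (pow2_ge_0 (1 - a ^ 2)); pose proof (pow2_ge_0 (k1 t)).
  apply Rsqr_0_uniq; unfold Rsqr; lra.
Qed.

Lemma frame_N_times_curvature a b k k1 tau tau1 t :
  geodesic_data a b k k1 tau tau1 -> k t ^ 2 + b ^ 2 <> 0 ->
  k t * frame_N a b k tau t = (a ^ 2 - 1 - k t ^ 2) / 2.
Proof.
  intros H Q; destruct (H t) as [_ [_ [_ [H4 _]]]]; unfold frame_N.
  apply Rmult_eq_reg_r with (k t ^ 2 + b ^ 2); [| exact Q].
  transitivity (b / 2 * (k t ^ 2 * (2 * tau t - b)) - b ^ 2 * k t ^ 2 / 2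
    - k t ^ 2 * (1 - a ^ 2 + k t ^ 2) / 2); [field; exact Q |].
  rewrite H4; field.
Qed.

(** Where k does not vanish this is the first integral for k^2; where it does,
    a^2 = 1 and the original first integral gives k'^2 = b^2. *)
Lemma curvature_derivative_square a b k k1 tau tau1 t :
  geodesic_data a b k k1 tau tau1 -> k t ^ 2 + b ^ 2 <> 0 ->
  k1 t ^ 2 = (k t ^ 2 + b ^ 2) * (1 - frame_N a b k tau t ^ 2).
Proof.
  intros H Q; destruct (Req_dec (k t) 0) as [K | K].
  - unfold frame_N; destruct (H t) as [_ [_ [_ [H4 H5]]]]; rewrite K in Q, H4, H5 |- *.
    assert (A1 : a ^ 2 = 1).
    { rewrite pow_ne_zero, Rmult_0_l in H4 by lia.
      symmetry in H4; apply Rmult_integral in H4; destruct H4 as [B | A1]; [| lra].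
      rewrite B in Q; exfalso; apply Q; ring. }
    rewrite A1 in H5; unfold Rdiv; rewrite !Rmult_0_l; lra.
  - pose proof (curvature_square_first_integral a b k k1 tau tau1 t H) as I.
    pose proof (frame_N_times_curvature a b k k1 tau tau1 t H Q) as E.
    apply Rmult_eq_reg_l with (4 * k t ^ 2); [| apply Rmult_integral_contrapositive_currified;
      [lra | now apply pow_nonzero]].
    transitivity ((2 * k t * k1 t) ^ 2); [ring | rewrite I].
    transitivity ((k t ^ 2 + b ^ 2) * (4 * k t ^ 2 - 4 * (k t * frame_N a b k tau t) ^ 2));
      [rewrite E; field | ring].
Qed.

Lemma frame_unit a b k k1 tau tau1 t :
  geodesic_data a b k k1 tau tau1 -> k t ^ 2 + b ^ 2 <> 0 ->
  frame_T b k k1 t ^ 2 + frame_N a b k tau t ^ 2 + frame_B b k k1 t ^ 2 = 1.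
Proof.
  intros H Q; pose proof (curvature_derivative_square a b k k1 tau tau1 t H Q) as E.
  transitivity (k1 t ^ 2 / (k t ^ 2 + b ^ 2) + frame_N a b k tau t ^ 2);
    [unfold frame_T, frame_B; field; exact Q | rewrite E; field; exact Q].
Qed.

(** This and the next two lemmas are the Frenet components of the equation
    v' = T - (T.v) v, in which T.v is [frame_T]. *)
Lemma frame_T_derive a b k k1 tau tau1 t :
  geodesic_data a b k k1 tau tau1 -> k t ^ 2 + b ^ 2 <> 0 ->
  is_derive (frame_T b k k1) t
    (1 - frame_T b k k1 t ^ 2 + k t * frame_N a b k tau t).
Proof.
  intros H Q; destruct (H t) as [H1 [H2 _]].
  pose proof (curvature_square_second_derivative a b k k1 tau tau1 t H) as D2.
  pose proof (curvature_square_first_integral a b k k1 tau tau1 t H) as I.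
  assert (Dq : forall (v : R -> R) (dv : R), is_derive v t dv ->
    is_derive (fun s => / 2 * v s / (k s ^ 2 + b ^ 2)) t
      (/ 2 * (dv / (k t ^ 2 + b ^ 2) - v t * (2 * k t * k1 t) / (k t ^ 2 + b ^ 2) ^ 2))).
  { intros v dv Dv.
    auto_derive; [split; [now exists dv | split; [now exists (k1 t) | split; [exact Q | easy]]] |].
    derive_subst; field; exact Q. }
  apply (is_derive_ext (fun s => / 2 * (2 * k s * k1 s) / (k s ^ 2 + b ^ 2))).
  { intros s; change (/ 2 * (2 * k s * k1 s) / (k s ^ 2 + b ^ 2)
      = k s * k1 s / (k s ^ 2 + b ^ 2)); f_equal; field. }
  eapply is_derive_eq; [apply (Dq _ _ D2) |]; cbv beta.
  rewrite (frame_N_times_curvature a b k k1 tau tau1 t H Q).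
  apply Rmult_eq_reg_r with (4 * (k t ^ 2 + b ^ 2) ^ 2);
    [| apply Rmult_integral_contrapositive_currified; [lra | now apply pow_nonzero]].
  transitivity (2 * (k t ^ 2 + b ^ 2) * ((- 3 * (k t ^ 2) ^ 2
    + (4 * (1 + a ^ 2) - 2 * b ^ 2) * k t ^ 2
      - (a ^ 2 - 1) ^ 2 + 2 * (a ^ 2 + 1) * b ^ 2) / 2) - 2 * (2 * k t * k1 t) ^ 2);
    [field; exact Q |].
  transitivity (4 * (k t ^ 2 + b ^ 2) ^ 2 * (1 + (a ^ 2 - 1 - k t ^ 2) / 2)
    - (2 * k t * k1 t) ^ 2); [rewrite I; field |].
  unfold frame_T; field; exact Q.
Qed.

Lemma frame_N_derive a b k k1 tau tau1 t :
  geodesic_data a b k k1 tau tau1 -> k t ^ 2 + b ^ 2 <> 0 ->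
  is_derive (frame_N a b k tau) t
    (- frame_T b k k1 t * frame_N a b k tau t - k t * frame_T b k k1 t
     + tau t * frame_B b k k1 t).
Proof.
  intros H Q; destruct (H t) as [H1 [_ [H3 _]]].
  pose proof (torsion_derivative a b k k1 tau tau1 t H) as E.
  pose proof (frame_N_times_curvature a b k k1 tau tau1 t H Q) as En.
  unfold frame_N at 1.
  auto_derive.
  { split; [now exists (k1 t) | split; [now exists (tau1 t) |
      split; [now exists (k1 t) | split; [now exists (k1 t) | split; [exact Q | easy]]]]]. }
  derive_subst.
  transitivity ((k1 t * (b * (tau t - b)) + b * (k t * tau1 t)
     - k1 t * (1 - a ^ 2 + 3 * k t ^ 2) / 2) / (k t ^ 2 + b ^ 2)
     - 2 * frame_T b k k1 t * frame_N a b k tau t).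
  { unfold frame_T, frame_N; field; exact Q. }
  replace (k t * tau1 t) with (- k1 t * (2 * tau t - b)) by lra.
  apply Rminus_diag_uniq.
  transitivity (k1 t / (k t ^ 2 + b ^ 2)
    * ((a ^ 2 - 1 - k t ^ 2) / 2 - k t * frame_N a b k tau t)).
  { unfold frame_T, frame_B; field; exact Q. }
  rewrite En; ring.
Qed.

Lemma frame_B_derive a b k k1 tau tau1 t :
  geodesic_data a b k k1 tau tau1 -> k t ^ 2 + b ^ 2 <> 0 ->
  is_derive (frame_B b k k1) t
    (- frame_T b k k1 t * frame_B b k k1 t - tau t * frame_N a b k tau t).
Proof.
  intros H Q; destruct (H t) as [H1 [H2 [_ [H4 _]]]].
  pose proof (curvature_derivative_square a b k k1 tau tau1 t H Q) as E.
  pose proof (frame_N_times_curvature a b k k1 tau tau1 t H Q) as En.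
  unfold frame_B at 1.
  auto_derive.
  { split; [eexists; apply H2 | split; [now exists (k1 t) | split; [exact Q | easy]]]. }
  derive_subst.
  set (n := frame_N a b k tau t) in *.
  assert (Z : b * (k t * (tau t * (tau t - b) + (1 + a ^ 2 - k t ^ 2) / 2))
    - b * k t * (1 - n ^ 2) - tau t * ((k t ^ 2 + b ^ 2) * n) = 0).
  { replace ((k t ^ 2 + b ^ 2) * n)
      with (k t * (b * (tau t - b) - (1 - a ^ 2 + k t ^ 2) / 2))
      by (unfold n, frame_N; field; exact Q).
    destruct (Req_dec (k t) 0) as [K | K]; [rewrite K; ring |].
    apply Rmult_eq_reg_l with (2 * k t); [| lra].
    transitivity (b * k t ^ 2 * (1 + a ^ 2 - k t ^ 2) - 2 * b * k t ^ 2
      + 2 * b * (k t * n) ^ 2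
      + (k t ^ 2 * (2 * tau t - b) + b * k t ^ 2) * (1 - a ^ 2 + k t ^ 2) / 2); [field |].
    rewrite En, H4; field. }
  transitivity (- (b * (k t * (tau t * (tau t - b) + (1 + a ^ 2 - k t ^ 2) / 2)))
    / (k t ^ 2 + b ^ 2) + 2 * b * k t * k1 t ^ 2 / (k t ^ 2 + b ^ 2) ^ 2);
    [field; exact Q |].
  transitivity (b * k t * k1 t ^ 2 / (k t ^ 2 + b ^ 2) ^ 2 - tau t * n);
    [| unfold frame_T, frame_B; field; exact Q].
  rewrite E.
  apply Rmult_eq_reg_r with (k t ^ 2 + b ^ 2); [| exact Q].
  field_simplify; [| exact Q | exact Q].
  lra.
Qed.

Lemma is_derive_scal_E3 (f : R -> R) (F : R -> E3) t (df : R) dF :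
  is_derive f t df -> is_derive F t dF ->
  is_derive (fun s => scal (f s) (F s)) t (plus (scal df (F t)) (scal (f t) dF)).
Proof.
  intros Hf HF; apply is_derive_E3 in HF as [F1 [F2 F3]].
  apply is_derive_E3; split; [| split]; apply @is_derive_mult;
    try assumption; intros; apply Rmult_comm.
Qed.

Lemma is_derive_E3_eq (f : R -> E3) t l l' : is_derive f t l -> l = l' -> is_derive f t l'.
Proof. now intros H <-. Qed.

Lemma constant_of_derive_zero_E3 (f : R -> E3) :
  (forall t, is_derive f t zero) -> forall s t, f s = f t.
Proof.
  intros H s t; apply E3_ext.
  - apply (is_derive_zero_const (fun u => Defs.c1 (f u))); intros u.
    exact (is_derive_c1 _ _ _ (H u)).
  - apply (is_derive_zero_const (fun u => c2 (f u))); intros u.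
    exact (is_derive_c2 _ _ _ (H u)).
  - apply (is_derive_zero_const (fun u => c3 (f u))); intros u.
    exact (is_derive_c3 _ _ _ (H u)).
Qed.

(** The polynomials in a family of generators are stable under differentiation
    as soon as the derivatives of the generators are such polynomials. *)
Inductive polynomial_in (G : (R -> R) -> Prop) : (R -> R) -> Prop :=
| poly_gen f : G f -> polynomial_in G f
| poly_const c : polynomial_in G (fun _ => c)
| poly_plus f g : polynomial_in G f -> polynomial_in G g ->
    polynomial_in G (fun t => f t + g t)
| poly_mult f g : polynomial_in G f -> polynomial_in G g ->
    polynomial_in G (fun t => f t * g t).

Lemma polynomial_smooth (G : (R -> R) -> Prop) :
  (forall f, G f -> exists g, polynomial_in G g /\ forall t, is_derive f t (g t)) ->
  forall f, polynomial_in G f -> forall n t, ex_derive_n f n t.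
Proof.
  intros HG; apply smooth_of_derive_closed; intros f Hf.
  induction Hf as [f Hf | c | f g Hf [f' [Pf Df]] Hg [g' [Pg Dg]]
    | f g Hf [f' [Pf Df]] Hg [g' [Pg Dg]]].
  - now apply HG.
  - exists (fun _ => 0); split; [apply poly_const | intros t; apply @is_derive_const].
  - exists (fun t => f' t + g' t); split; [now apply poly_plus |].
    intros t; apply @is_derive_plus; auto.
  - exists (fun t => f' t * g t + f t * g' t); split.
    { apply poly_plus; now apply poly_mult. }
    intros t; apply @is_derive_mult; auto; intros; apply Rmult_comm.
Qed.

Definition coordinate (c : E3 -> R) : Prop := c = Defs.c1 \/ c = c2 \/ c = c3.

Lemma coordinate_derive c (F : R -> E3) t l :
  coordinate c -> is_derive F t l -> is_derive (fun s => c (F s)) t (c l).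
Proof.
  intros [-> | [-> | ->]] H; apply is_derive_E3 in H; apply H.
Qed.

Lemma coordinate_plus c u v : coordinate c -> c (plus u v) = c u + c v.
Proof. now intros [-> | [-> | ->]]. Qed.
Lemma coordinate_minus c u v : coordinate c -> c (minus u v) = c u - c v.
Proof. now intros [-> | [-> | ->]]. Qed.
Lemma coordinate_scal c (k : R) u : coordinate c -> c (scal k u) = k * c u.
Proof. now intros [-> | [-> | ->]]. Qed.

(** All derivatives are polynomials in the derivatives of kappa and tau and in the
    coordinates of x, T, N, B and v. *)
Lemma smooth_system (kappa tau : R -> R) (x T N B v : R -> E3) :
  analytic (V := R_NormedModule) kappa -> analytic (V := R_NormedModule) tau ->
  (forall t, frenet_at kappa tau T N B t) ->
  (forall t, is_derive x t (T t)) ->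
  (forall t, is_derive v t (minus (T t) (scal (dot (T t) (v t)) (v t)))) ->
  smooth x /\ smooth (fun t => minus (x t) (v t)).
Proof.
  intros Hk Ht HF Hx Hv.
  set (G := fun f : R -> R => (exists n, f = Derive_n kappa n) \/
    (exists n, f = Derive_n tau n) \/
    exists c F, coordinate c /\ (F = x \/ F = T \/ F = N \/ F = B \/ F = v) /\
      f = fun t => c (F t)).
  assert (GF : forall c F, coordinate c -> F = x \/ F = T \/ F = N \/ F = B \/ F = v ->
    polynomial_in G (fun t => c (F t)))
    by (intros c F Hc HFF; apply poly_gen; right; right; now exists c, F).
  assert (Gk : polynomial_in G kappa) by (apply poly_gen; left; now exists 0%nat).
  assert (Gt : polynomial_in G tau) by (apply poly_gen; right; left; now exists 0%nat).
  assert (Gopp : forall f, polynomial_in G f -> polynomial_in G (fun t => -1 * f t))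
    by (intros f Hf; apply (poly_mult G (fun _ => -1)); [apply poly_const | exact Hf]).
  assert (C1 : coordinate Defs.c1) by now left.
  assert (C2 : coordinate c2) by (right; now left).
  assert (C3 : coordinate c3) by (right; now right).
  assert (S : forall f, polynomial_in G f -> forall n t, ex_derive_n f n t).
  { apply polynomial_smooth; intros f [[n ->] | [[n ->] | [c [F [Hc [HFF ->]]]]]].
    - exists (Derive_n kappa (S n)); split; [apply poly_gen; left; now exists (S n) |].
      intros t; apply Derive_correct, (analytic_ex_derive_n kappa Hk (S n)).
    - exists (Derive_n tau (S n)); split; [apply poly_gen; right; left; now exists (S n) |].
      intros t; apply Derive_correct, (analytic_ex_derive_n tau Ht (S n)).
    - destruct HFF as [-> | [-> | [-> | [-> | ->]]]].
      + exists (fun t => c (T t)); split; [apply GF; auto |].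
        intros t; apply coordinate_derive; auto.
      + exists (fun t => kappa t * c (N t)); split.
        { apply poly_mult; [exact Gk | apply GF; auto]. }
        intros t; rewrite <- coordinate_scal by exact Hc.
        destruct (HF t) as [DT [_ DB]]; now apply coordinate_derive.
      + exists (fun t => (-1 * kappa t) * c (T t) + tau t * c (B t)); split.
        { apply poly_plus; apply poly_mult; auto 10. }
        intros t; destruct (HF t) as [_ [D _]].
        replace (-1 * kappa t) with (- kappa t) by ring.
        rewrite <- !coordinate_scal, <- coordinate_plus by exact Hc.
        now apply coordinate_derive.
      + exists (fun t => (-1 * tau t) * c (N t)); split.
        { apply poly_mult; auto. }
        intros t; replace (-1 * tau t) with (- tau t) by ring.
        rewrite <- coordinate_scal by exact Hc.
        destruct (HF t) as [DT [_ DB]]; now apply coordinate_derive.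
      + exists (fun t => c (T t) + -1 * ((Defs.c1 (T t) * Defs.c1 (v t)
          + c2 (T t) * c2 (v t) + c3 (T t) * c3 (v t)) * c (v t))); split.
        { apply (poly_plus G (fun t => c (T t))); [apply GF; auto |].
          apply Gopp; apply (poly_mult G _ (fun t => c (v t))); [| apply GF; auto 10].
          apply (poly_plus G (fun t => Defs.c1 (T t) * Defs.c1 (v t) + c2 (T t) * c2 (v t))
            (fun t => c3 (T t) * c3 (v t))); [apply (poly_plus G
            (fun t => Defs.c1 (T t) * Defs.c1 (v t)) (fun t => c2 (T t) * c2 (v t))) |].
          - apply (poly_mult G (fun t => Defs.c1 (T t)) (fun t => Defs.c1 (v t))); auto 10.
          - apply (poly_mult G (fun t => c2 (T t)) (fun t => c2 (v t))); auto 10.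
          - apply (poly_mult G (fun t => c3 (T t)) (fun t => c3 (v t))); auto 10. }
        intros t; fold (dot (T t) (v t)).
        replace (_ + _) with (c (minus (T t) (scal (dot (T t) (v t)) (v t)))).
        * now apply coordinate_derive.
        * rewrite coordinate_minus, coordinate_scal by exact Hc; ring. }
  split; intros n t.
  - split; [| split]; apply S; auto.
  - assert (Y : forall c, coordinate c ->
      ex_derive_n (fun u => c (minus (x u) (v u))) n t).
    { intros c Hc.
      apply (ex_derive_n_ext (fun u => c (x u) + -1 * c (v u))).
      { intros u; rewrite coordinate_minus by exact Hc.
        change (c (x u) + -1 * c (v u) = c (x u) - c (v u)); ring. }
      apply S; apply (poly_plus G (fun u => c (x u)) (fun u => -1 * c (v u))); auto 10. }
    auto.
Qed.

(** The back track is x - v, with v given by [frame_T], [frame_N] and [frame_B].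
    The vector T - r is constant because r' = kappa N = T', and the costate equation for [r] is an identity
    between the Frenet components. *)
Lemma front_track_is_geodesic a b kappa k1 tau tau1 x T N B :
  geodesic_data a b kappa k1 tau tau1 -> (exists s, kappa s <> 0) ->
  analytic (V := R_NormedModule) kappa -> analytic (V := R_NormedModule) tau ->
  (forall t, frenet_at kappa tau T N B t) ->
  (forall t, dot (T t) (T t) = 1 /\ dot (N t) (N t) = 1 /\ dot (B t) (B t) = 1 /\
    dot (T t) (N t) = 0 /\ dot (T t) (B t) = 0 /\ dot (N t) (B t) = 0) ->
  (forall t, is_derive x t (T t)) ->
  geodesic_front_track x.
Proof.
  intros H Hnz Hk Ht HF HO Hx.
  assert (Q : forall t, kappa t ^ 2 + b ^ 2 <> 0)
    by (intros t; now apply (curvature_momentum_nonzero a b kappa k1 tau tau1)).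
  set (al := frame_T b kappa k1); set (be := frame_N a b kappa tau);
  set (ga := frame_B b kappa k1).
  set (comb := fun (f g h : R -> R) (t : R) =>
    plus (plus (scal (f t) (T t)) (scal (g t) (N t))) (scal (h t) (B t)) : E3).
  assert (Dcomb : forall (f g h : R -> R) (df dg dh : R) t,
    is_derive f t df -> is_derive g t dg -> is_derive h t dh ->
    is_derive (comb f g h) t (plus (plus (scal (df - kappa t * g t) (T t))
      (scal (dg + kappa t * f t - tau t * h t) (N t))) (scal (dh + tau t * g t) (B t)))).
  { intros f g h df dg dh t Df Dg Dh; destruct (HF t) as [DT [DN DB]].
    eapply is_derive_E3_eq.
    - apply @is_derive_plus; [apply @is_derive_plus |]; apply is_derive_scal_E3; eassumption.
    - apply E3_ext; E3_ring. }
  assert (Cdot : forall (f g h f' g' h' : R -> R) t,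
    dot (comb f g h t) (comb f' g' h' t) = f t * f' t + g t * g' t + h t * h' t).
  { intros f g h f' g' h' t; destruct (HO t) as [TT [NN [BB [TN [TB NB]]]]]; unfold comb.
    rewrite !dot_plus_l, !dot_plus_r, !dot_scal_l, !dot_scal_r,
      (dot_comm (N t) (T t)), (dot_comm (B t) (T t)), (dot_comm (B t) (N t)),
      TT, NN, BB, TN, TB, NB; ring. }
  set (v := comb al be ga).
  set (r := comb (fun t => (1 - a ^ 2 + kappa t ^ 2) / 2) k1
    (fun t => kappa t * (tau t - b))).
  assert (TC : forall t, T t = comb (fun _ => 1) (fun _ => 0) (fun _ => 0) t)
    by (intros t; apply E3_ext; unfold comb; E3_ring).
  assert (Tv : forall t, dot (T t) (v t) = al t)
    by (intros t; rewrite TC; unfold v; rewrite Cdot; ring).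
  assert (rT : forall t, dot (r t) (T t) = (1 - a ^ 2 + kappa t ^ 2) / 2)
    by (intros t; rewrite (TC t); unfold r; rewrite Cdot; ring).
  assert (Dv : forall t, is_derive v t (minus (T t) (scal (dot (T t) (v t)) (v t)))).
  { intros t; rewrite Tv.
    eapply is_derive_E3_eq.
    - apply Dcomb; [apply (frame_T_derive a b kappa k1 tau tau1) |
        apply (frame_N_derive a b kappa k1 tau tau1) |
        apply (frame_B_derive a b kappa k1 tau tau1)]; auto.
    - fold al be ga; unfold v, comb; apply E3_ext; E3_ring. }
  assert (Vv : forall t, dot (v t) (v t) = 1).
  { intros t; unfold v; rewrite Cdot.
    rewrite <- (frame_unit a b kappa k1 tau tau1 t H (Q t)); fold al be ga; ring. }
  assert (rv : forall t, dot (r t) (v t) = 0).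
  { intros t; unfold r, v; rewrite Cdot; unfold al, be, ga, frame_T, frame_N, frame_B.
    field; apply Q. }
  assert (Dr : forall t, is_derive r t (scal (kappa t) (N t))).
  { intros t; destruct (H t) as [H1 [H2 [H3 _]]].
    pose proof (torsion_derivative a b kappa k1 tau tau1 t H) as Et.
    eapply is_derive_E3_eq.
    - apply (Dcomb _ _ _ (kappa t * k1 t)
        (kappa t * (tau t * (tau t - b) + (1 + a ^ 2 - kappa t ^ 2) / 2))
        (k1 t * (tau t - b) + kappa t * tau1 t)).
      + auto_derive; [now exists (k1 t) |].
        derive_subst; field.
      + exact H2.
      + auto_derive; [split; [now exists (k1 t) | split; [now exists (tau1 t) | easy]] |].
        derive_subst; ring.
    - replace (k1 t * (tau t - b) + kappa t * tau1 t + tau t * k1 t) with 0 by lra.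
      replace (_ - kappa t * k1 t) with 0 by ring.
      replace (_ + _ - _) with (kappa t) by field.
      apply E3_ext; E3_ring. }
  set (p := minus (T 0) (r 0)).
  assert (HT : forall t, T t = plus p (r t)).
  { intros t; unfold p.
    rewrite (constant_of_derive_zero_E3 (fun u => minus (T u) (r u))) with (t := t).
    - apply E3_ext; E3_ring.
    - intros u; destruct (HF u) as [DT _]; eapply is_derive_E3_eq.
      + apply @is_derive_minus; [exact DT | apply Dr].
      + apply E3_ext; E3_ring. }
  assert (Dr' : forall t, scal (kappa t) (N t) =
    minus (scal (dot (T t) (v t)) (r t)) (scal (dot (r t) (T t)) (v t))).
  { intros t; rewrite Tv, rT.
    destruct (H t) as [_ [_ [_ [H4 _]]]].
    assert (EN : al t * k1 t - (1 - a ^ 2 + kappa t ^ 2) / 2 * be t = kappa t).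
    { pose proof (curvature_derivative_square a b kappa k1 tau tau1 t H (Q t)) as E.
      pose proof (frame_N_times_curvature a b kappa k1 tau tau1 t H (Q t)) as En.
      fold be in E, En.
      replace (al t * k1 t) with (kappa t * (k1 t ^ 2 / (kappa t ^ 2 + b ^ 2)))
        by (unfold al, frame_T; field; apply Q).
      rewrite E; replace ((1 - a ^ 2 + kappa t ^ 2) / 2) with (- (kappa t * be t)) by lra.
      field; apply Q. }
    assert (EB : al t * (kappa t * (tau t - b)) - (1 - a ^ 2 + kappa t ^ 2) / 2 * ga t = 0).
    { transitivity (k1 t / (kappa t ^ 2 + b ^ 2) * ((kappa t ^ 2 * (2 * tau t - b)
        - b * kappa t ^ 2) / 2 + b * (1 - a ^ 2 + kappa t ^ 2) / 2)).
      - unfold al, ga, frame_T, frame_B; field; apply Q.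
      - rewrite H4; field; apply Q. }
    transitivity (plus (plus (scal 0 (T t))
        (scal (al t * k1 t - (1 - a ^ 2 + kappa t ^ 2) / 2 * be t) (N t)))
      (scal (al t * (kappa t * (tau t - b)) - (1 - a ^ 2 + kappa t ^ 2) / 2 * ga t) (B t))).
    - rewrite EN, EB; apply E3_ext; E3_ring.
    - unfold r, v, comb; apply E3_ext; E3_ring. }
  set (y := fun t => minus (x t) (v t)).
  assert (xy : forall t, minus (x t) (y t) = v t)
    by (intros t; unfold y; apply E3_ext; E3_ring).
  destruct (smooth_system kappa tau x T N B v Hk Ht HF Hx Dv) as [Sx Sy].
  assert (BP : bicycle_path x y).
  { split; [exact Sx | split; [exact Sy |]].
    intros t; split; [rewrite xy; now apply norm_eq_1 |].
    exists (al t); rewrite xy.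
    eapply is_derive_E3_eq; [apply @is_derive_minus; [apply Hx | apply Dv] |].
    rewrite Tv; apply E3_ext; E3_ring. }
  exists y; split; [exact BP |].
  intros t0 t1 X Y.
  apply (length_critical_of_costate x y T r p t0 t1 X Y BP Hx).
  - intros t; apply (HO t).
  - exact HT.
  - intros t; rewrite xy; apply rv.
  - intros t; rewrite xy, <- Dr'; apply Dr.
Qed.

(** * Torsion shifting *)

Lemma linear_of_zero_curvature (kappa : R -> R) (x T N : R -> E3) :
  (forall t, is_derive x t (T t)) ->
  (forall t, is_derive T t (scal (kappa t) (N t))) ->
  (forall t, kappa t = 0) -> linear_track x.
Proof.
  intros Hx HT K.
  assert (T0 : forall t, T t = T 0).
  { intros t; apply constant_of_derive_zero_E3; intros s.
    eapply is_derive_E3_eq; [apply HT |]; rewrite K; apply E3_ext; E3_ring. }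
  exists (x 0), (T 0); intros t; exists t.
  assert (E : minus (x t) (scal t (T 0)) = minus (x 0) (scal 0 (T 0))).
  { apply (constant_of_derive_zero_E3 (fun s => minus (x s) (scal s (T 0)))); intros s.
    eapply is_derive_E3_eq.
    - apply @is_derive_minus; [apply Hx |].
      apply (is_derive_scal_E3 (fun s => s) (fun _ => T 0) s 1 zero);
        [apply @is_derive_id | apply @is_derive_const].
    - rewrite (T0 s); apply E3_ext; E3_ring. }
  replace (x t) with (plus (minus (x t) (scal t (T 0))) (scal t (T 0)))
    by (apply E3_ext; E3_ring).
  rewrite E; apply E3_ext; E3_ring.
Qed.

(** Differentiating (x - p) x d = 0 twice gives T x d = 0 and N x d = 0, so d is
    parallel to two orthogonal vectors. *)
Lemma nonlinear_of_curvature (kappa : R -> R) (x T N : R -> E3) s :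
  (forall t, is_derive x t (T t)) ->
  (forall t, is_derive T t (scal (kappa t) (N t))) ->
  (forall t, dot (T t) (T t) = 1) -> (forall t, dot (N t) (N t) = 1) ->
  (forall t, dot (T t) (N t) = 0) ->
  kappa s <> 0 -> ~ linear_track x.
Proof.
  intros Hx HT TT NN TN K [p [d Hl]].
  assert (Z : forall t, cross (minus (x t) p) d = zero).
  { intros t; destruct (Hl t) as [c ->]; apply E3_ext; E3_ring. }
  assert (D : forall (f : R -> E3) (l : E3) t, is_derive f t l ->
    (forall u, cross (f u) d = zero) -> cross l d = zero).
  { intros f l t Df Zf.
    pose proof (is_derive_cross f (fun _ => d) t l zero Df (is_derive_const d t)) as Dc.
    apply (is_derive_ext _ (fun _ => zero)) in Dc; [| exact Zf].
    apply is_derive_E3 in Dc as [E1 [E2 E3]].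
    apply is_derive_unique in E1, E2, E3.
    rewrite Derive_const in E1, E2, E3.
    replace (cross l d) with (plus (cross l d) (cross (f t) zero))
      by (apply E3_ext; E3_ring).
    symmetry; apply E3_ext; assumption. }
  assert (ZT : forall t, cross (T t) d = zero).
  { intros t; apply (D (fun t => minus (x t) p) _ t); [| exact Z].
    eapply is_derive_E3_eq; [apply @is_derive_minus; [apply Hx | apply @is_derive_const] |].
    apply E3_ext; E3_ring. }
  assert (ZN : cross (N s) d = zero).
  { pose proof (D T _ s (HT s) ZT) as E.
    assert (I : / kappa s * kappa s = 1) by (apply Rinv_l, K).
    transitivity (scal (/ kappa s * kappa s) (cross (N s) d)).
    { rewrite I; apply E3_ext; E3_ring. }
    transitivity (scal (/ kappa s) (cross (scal (kappa s) (N s)) d)).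
    { apply E3_ext; E3_ring. }
    rewrite E; apply E3_ext; E3_ring. }
  (* The triple product u x (u x d) is (u.d) u - (u.u) d. *)
  assert (ed : forall u : E3, dot u u = 1 -> cross u d = zero -> d = scal (dot u d) u).
  { intros u Hu Hc.
    transitivity (plus (scal (dot u u) d) (cross u (cross u d))).
    - rewrite Hu, Hc; apply E3_ext; E3_ring.
    - apply E3_ext; E3_ring. }
  pose proof (ed _ (TT s) (ZT s)) as dT; pose proof (ed _ (NN s) ZN) as dN.
  assert (Td : dot (T s) d = 0) by (rewrite dN, dot_scal_r, TN; ring).
  assert (d0 : d = zero) by (rewrite dT, Td; apply E3_ext; E3_ring).
  assert (xp : forall t, x t = p).
  { intros t; destruct (Hl t) as [c ->]; rewrite d0; apply E3_ext; E3_ring. }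
  assert (T0 : T s = zero).
  { pose proof (Hx s) as Dx; apply (is_derive_ext _ (fun _ => p)) in Dx; [| exact xp].
    apply is_derive_E3 in Dx as [E1 [E2 E3]].
    apply is_derive_unique in E1, E2, E3; rewrite Derive_const in E1, E2, E3.
    symmetry; apply E3_ext; assumption. }
  specialize (TT s); rewrite T0 in TT.
  assert (W : dot zero zero = 0) by E3_ring; lra.
Qed.

Lemma primitive_E3 (T : R -> E3) :
  (forall t, exists l, is_derive T t l) -> exists x, forall t, is_derive x t (T t).
Proof.
  intros HT.
  assert (C : forall c, coordinate c -> forall t, continuity_pt (fun u => c (T u)) t).
  { intros c Hc t; destruct (HT t) as [l Hl].
    eapply is_derive_continuity_pt, coordinate_derive; eassumption. }
  exists (fun t => (RInt (fun u => Defs.c1 (T u)) 0 t, RInt (fun u => c2 (T u)) 0 t,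
    RInt (fun u => c3 (T u)) 0 t)).
  intros t; apply is_derive_E3; split; [| split].
  - apply (is_derive_RInt_continuous (fun u => Defs.c1 (T u)) 0), C; now left.
  - apply (is_derive_RInt_continuous (fun u => c2 (T u)) 0), C; right; now left.
  - apply (is_derive_RInt_continuous (fun u => c3 (T u)) 0), C; right; now right.
Qed.

Theorem proposition3p10 :
  forall (a b : R) (x : R -> E3) (kappa tau : R -> R),
    0 < a ->
    geodesic_front_track x ->
    ~ linear_track x ->
    ~ circular_track x ->
    curvature_torsion x kappa tau ->
    geodesic_equations a b kappa tau ->
    (exists x' : R -> E3, front_track_with_parameters (1 / a) (- (b / a)) x') /\
    (forall x' : R -> E3,
        front_track_with_parameters (1 / a) (- (b / a)) x' ->
        exists t0 : R,
          curvature_torsion (fun t => x' (t + t0))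
            (fun t => 1 / a * kappa (t / a))
            (fun t => 1 / a * tau (t / a) - b / a)).
Proof.
  intros a b x kappa tau Ha _ Hnl _ [T [N [B [_ [[Ak At] HF]]]]] Heq.
  pose proof (geodesic_data_of_equations a b kappa tau Ak At Heq) as Hd.
  assert (Hnz : exists s, kappa s <> 0).
  { apply not_all_ex_not; intros K; apply Hnl.
    apply (linear_of_zero_curvature kappa x T N); auto; intros t;
      now destruct (HF t) as [_ [? [? _]]]. }
  pose proof (geodesic_data_torsion_shift a b _ _ _ _ Ha Hd) as Hd'.
  assert (Hnz' : exists s, 1 / a * kappa (s / a) <> 0).
  { destruct Hnz as [s Hs]; exists (s * a).
    replace (s * a / a) with s by (field; lra).
    apply Rmult_integral_contrapositive_currified; [| exact Hs].
    apply Rgt_not_eq, Rdiv_lt_0_compat; lra. }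
  assert (Ha' : 0 < 1 / a) by (apply Rdiv_lt_0_compat; lra).
  set (k' := fun t => 1 / a * kappa (t / a)) in *.
  set (k1' := fun t => (1 / a) ^ 2 * Derive kappa (t / a)) in *.
  set (tau' := fun t => 1 / a * tau (t / a) - b / a) in *.
  assert (Aff : forall (f g : R -> R) c, analytic (V := R_NormedModule) f ->
    (forall t, g t = 1 / a * f (/ a * t) + c) -> analytic (V := R_NormedModule) g).
  { intros f g c Hf Hg t0.
    destruct (analytic_affine f (1 / a) (/ a) c Hf t0) as [cs H]; exists cs.
    revert H; apply filter_imp; intros t; now rewrite Hg. }
  assert (Ak' : analytic (V := R_NormedModule) k').
  { apply (Aff kappa _ 0 Ak); intros t; unfold k', Rdiv; rewrite (Rmult_comm t); ring. }
  assert (At' : analytic (V := R_NormedModule) tau').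
  { apply (Aff tau _ (- (b / a)) At); intros t; unfold tau', Rdiv; rewrite (Rmult_comm t); ring. }
  split.
  - destruct (frenet_frame_exists k' tau' Ak' At') as [T' [N' [B' [AF [HF' [HO HB]]]]]].
    destruct (primitive_E3 T') as [x' Hx'].
    { intros t; destruct (HF' t) as [DT _]; eexists; exact DT. }
    exists x'; split; [| split].
    + now apply (front_track_is_geodesic (1 / a) (- (b / a)) k' k1' tau' _ x' T' N' B' Hd').
    + destruct Hnz' as [s Hs].
      apply (nonlinear_of_curvature k' x' T' N' s); auto; intros t;
        destruct (HO t) as [TT [NN [_ [TN _]]]], (HF' t) as [DT _]; assumption.
    + exists k', tau'; split.
      * exists T', N', B'; split; [exact AF | split; [now split |]].
        intros t; destruct (HO t) as [TT [NN [BB [TN _]]]].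
        rewrite !norm_eq_1; split; [auto | exact (conj (Hx' t) (HF' t))].
      * now apply (geodesic_equations_of_data _ _ k' k1' tau' _ Hd').
  - intros x' [_ [Hnl' [l [sigma [[T' [N' [B' [AF [[Al As] HF']]]]] Heql]]]]].
    pose proof (geodesic_data_of_equations _ _ l sigma Al As Heql) as Hl.
    assert (Hnzl : exists s, l s <> 0).
    { apply not_all_ex_not; intros K; apply Hnl'.
      apply (linear_of_zero_curvature l x' T' N'); auto; intros t;
        now destruct (HF' t) as [_ [? [? _]]]. }
    destruct (curvature_maximum _ _ _ _ _ _ Ha' Hd' Hnz') as [t1 [M1 Z1]].
    destruct (curvature_maximum _ _ _ _ _ _ Ha' Hl Hnzl) as [t2 [M2 Z2]].
    exists (t2 - t1).
    pose proof (geodesic_data_translate _ _ _ _ _ _ (t2 - t1) Hl) as Hls.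
    destruct (curvature_determined _ _ _ _ _ _ _ _ _ _ t1 Hd' Hls) as [e [He Hle]].
    + intros K; rewrite K in M1.
      assert (0 < (1 / a + 1) ^ 2) by (apply pow_lt; lra); nra.
    + cbv beta; replace (t1 + (t2 - t1)) with t2 by ring; now rewrite M1, M2.
    + exact Z1.
    + cbv beta; now replace (t1 + (t2 - t1)) with t2 by ring.
    + assert (Ee : e * e = 1) by (destruct He as [-> | ->]; ring).
      exists (fun t => T' (t + (t2 - t1))), (fun t => scal e (N' (t + (t2 - t1)))),
        (fun t => scal e (B' (t + (t2 - t1)))).
      destruct AF as [AT [AN AB]].
      split; [split; [| split] | split; [now split |]].
      * now apply analytic_translate.
      * apply analytic_scal; now apply analytic_translate.
      * apply analytic_scal; now apply analytic_translate.
      * intros t; destruct (Hle t) as [El Es].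
        destruct (HF' (t + (t2 - t1))) as [[n1 [n2 [n3 n4]]] [D1 [D2 [D3 D4]]]].
        assert (Sh : forall (f : R -> E3) df, is_derive f (t + (t2 - t1)) df ->
          is_derive (fun t => f (t + (t2 - t1))) t df).
        { intros f df Df; replace df with (scal 1 df) by (apply E3_ext; E3_ring).
          apply (is_derive_comp f (fun t => t + (t2 - t1))); [exact Df |].
          auto_derive; [easy | ring]. }
        assert (Sc : forall (f : R -> E3) df, is_derive f (t + (t2 - t1)) df ->
          is_derive (fun t => scal e (f (t + (t2 - t1)))) t (scal e df)).
        { intros f df Df; apply (is_derive_linear (fun u : E3 => scal e u));
            [| now apply Sh].
          apply (is_linear_scal_r e); intros; apply Rmult_comm. }
        set (s := t + (t2 - t1)) in *.
        assert (Ek : k' t = e * l s) by (rewrite El, <- Rmult_assoc, Ee; ring).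
        split; [split; [exact n1 | split; [| split]] | split; [| split; [| split]]].
        -- rewrite norm_eq_1 in n2 |- *.
           rewrite dot_scal_l, dot_scal_r, n2, <- Rmult_assoc, Ee; ring.
        -- rewrite dot_scal_r, n3; ring.
        -- rewrite n4; apply E3_ext; E3_ring.
        -- now apply Sh.
        -- eapply is_derive_E3_eq; [apply Sh, D2 |].
           transitivity (scal (e * e * l s) (N' s)).
           { rewrite Ee; apply E3_ext; E3_ring. }
           change (1 / a * kappa (t / a)) with (k' t); rewrite Ek.
           apply E3_ext; E3_ring.
        -- eapply is_derive_E3_eq; [apply Sc, D3 |].
           change (1 / a * kappa (t / a)) with (k' t).
           change (1 / a * tau (t / a) - b / a) with (tau' t).
           rewrite Ek, <- Es; fold s; apply E3_ext; E3_ring.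
        -- eapply is_derive_E3_eq; [apply Sc, D4 |].
           change (1 / a * tau (t / a) - b / a) with (tau' t).
           rewrite <- Es; fold s; apply E3_ext; E3_ring.
Qed.
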